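(* Let $d\ge1$ and $n\ge0$ be integers. Let $\phi,\psi_1,\dots,\psi_d\in C_b^{n}(\mathbb{R})$ be kernels of order $n$ such that for every $l=1,\dots,n$ the series $$\sum_{k\in\mathbb{Z}}|u-k|^{n}\,|\phi^{(l)}(u-k)|\quad\text{and}\quad\sum_{k\in\mathbb{Z}}|u-k|^{n}\,|\psi_i^{(l)}(u-k)|,\qquad i=1,\dots,d,$$ are uniformly convergent in $u\in\mathbb{R}$. Then for every $f\in C^{n}(\mathbb{R}\times\mathbb{R}^{d})$ and all integers $p\ge0$ and $\mathbf{q}\in\mathbb{Z}_+^d$ with $p+|\mathbf{q}|\le n$, $$\lim_{w\to\infty}\big\|\partial^{(p,\mathbf{q})}K_{n,w}^{\phi,\psi}f-\partial^{(p,\mathbf{q})}f\big\|_\infty=0.$$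
   Context: Notation. For a multi-index $\mathbf{j}\in\mathbb{Z}_+^d$ (non-negative integer entries): $|\mathbf{j}|=j_1+\dots+j_d$, $\mathbf{j}!=\prod_i j_i!$, and $\mathbf{x}^{\mathbf{j}}=\prod_i x_i^{j_i}$ for $\mathbf{x}\in\mathbb{R}^d$; $0^0=1$. Points of $\mathbb{R}\times\mathbb{R}^d$ are written $(x,\mathbf{y})$; $\partial^{(l,\mathbf{j})}f=\frac{\partial^{l+|\mathbf{j}|}f}{\partial x^l\partial y_1^{j_1}\cdots\partial y_d^{j_d}}$; $\|f\|_\infty=\sup|f|$ over $\mathbb{R}\times\mathbb{R}^d$. Function spaces. $C_b^{n}(\mathbb{R})$ is the space of $n$-times continuously differentiable real functions on $\mathbb{R}$ whose derivatives of order at most $n$ are bounded and continuous. $C^{n}(\mathbb{R}\times\mathbb{R}^d)$ is the space of $n$-times continuously differentiable real functions all of whose partial derivatives of order exactly $n$ are bounded and uniformly continuous. Uniform convergence of moment series. For $g:\mathbb{R}\to\mathbb{R}$, the series $\sum_{k\in\mathbb{Z}}|u-k|^{n}|g(u-k)|$ is called uniformly convergent in $u\in\mathbb{R}$ if it converges for every $u$ and $\lim_{R\to\infty}\sup_{u\in\mathbb{R}}\sum_{k\in\mathbb{Z},\,|u-k|\ge R}|u-k|^{n}|g(u-k)|=0$. Kernels. For $\chi:\mathbb{R}\to\mathbb{R}$ and $\beta\ge0$ put $M_\beta(\chi)=\sup_{u\in\mathbb{R}}\sum_{k\in\mathbb{Z}}|u-k|^{\beta}|\chi(u-k)|$. The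 function $\chi$ is a kernel of order $n$ if (i) $\sum_{k\in\mathbb{Z}}\chi(u-k)=1$ for every $u\in\mathbb{R}$; (ii) the series $\sum_{k\in\mathbb{Z}}|u-k|^{n}|\chi(u-k)|$ is uniformly convergent in $u\in\mathbb{R}$, i.e. it converges for every $u$ and $\lim_{R\to\infty}\sup_{u\in\mathbb{R}}\sum_{k\in\mathbb{Z},\,|u-k|\ge R}|u-k|^{n}|\chi(u-k)|=0$, and $M_\beta(\chi)<\infty$ for all $0\le\beta\le n$. Operator. For $w>0$, $k\in\mathbb{Z}$, $\mathbf{m}\in\mathbb{Z}^d$ let $I_k^w=[\frac{k}{w},\frac{k+1}{w}]$ and $I_{\mathbf{m}}^w=\prod_{i=1}^d[\frac{m_i}{w},\frac{m_i+1}{w}]$. The Hermite-type sampling Kantorovich operator is $$K_{n,w}^{\phi,\psi}f(x,\mathbf{y})=\sum_{k\in\mathbb{Z}}\sum_{\mathbf{m}\in\mathbb{Z}^d}\phi(wx-k)\prod_{i=1}^d\psi_i(wy_i-m_i)\left(\sum_{l+|\mathbf{j}|\le n}\frac{1}{l!\,\mathbf{j}!}\,w^{d+1}\int_{I_k^w}\int_{I_{\mathbf{m}}^w}\frac{\partial^{l+|\mathbf{j}|}f(u,\mathbf{v})}{\partial u^l\partial\mathbf{v}^{\mathbf{j}}}(x-u)^l(\mathbf{y}-\mathbf{v})^{\mathbf{j}}\,d\mathbf{v}\,du\right),$$ where the inner sum is over integers $l\ge0$ and $\mathbf{j}\in\mathbb{Z}_+^d$. *)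

(* Defs.v *)
From HB Require Import structures.
From mathcomp Require Import all_boot all_order all_algebra.
From mathcomp Require Import all_classical all_reals all_analysis.

Set Implicit Arguments.
Unset Strict Implicit.
Unset Printing Implicit Defensive.

Import Order.TTheory GRing.Theory Num.Theory.
Import numFieldNormedType.Exports.

Local Open Scope classical_set_scope.
Local Open Scope ring_scope.

Section Series.
Context {R : realType}.

(* Sum of an absolutely convergent family of reals.  The value is meaningful
   only under [summable setT (EFin \o a)]. *)
Definition rsum (I : choiceType) (a : I -> R) : R :=
  fine (\esum_(i in setT) ((EFin \o a)^\+)%E i)
  - fine (\esum_(i in setT) ((EFin \o a)^\-)%E i).

Definition uniformly_convergent_moment (n : nat) (g : R -> R) : Prop :=
  (forall u : R,
     (\esum_(k in [set: int])
        (`|u - k%:~R| ^+ n * `|g (u - k%:~R)|)%:E < +oo)%E) /\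
  ereal_sup [set \esum_(k in [set k : int | (r <= `|u - k%:~R|)%R])
               (`|u - k%:~R| ^+ n * `|g (u - k%:~R)|)%:E | u in [set: R]]
    @[r --> +oo%R] --> 0%E.

(* [powR 0 0 = 1], so the convention 0^0 = 1 holds when [beta = 0]. *)
Definition abs_moment (beta : R) (chi : R -> R) : \bar R :=
  ereal_sup [set \esum_(k in [set: int])
               (`|u - k%:~R| `^ beta * `|chi (u - k%:~R)|)%:E | u in [set: R]].

(* The series in the first clause converges absolutely, by the third clause
   with [beta = 0]. *)
Definition kernel_of_order (n : nat) (chi : R -> R) : Prop :=
  [/\ forall u : R, rsum (fun k : int => chi (u - k%:~R)) = 1,
      uniformly_convergent_moment n chi &
      forall beta : R, 0 <= beta <= n%:R -> (abs_moment beta chi < +oo)%E].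

Definition Cb (n : nat) (g : R -> R) : Prop :=
  (forall l : nat, (l < n)%N -> forall x : R, derivable (g^`(l))%classic x 1) /\
  (forall l : nat, (l <= n)%N -> continuous (g^`(l))%classic /\ bounded_fun (g^`(l))%classic).

End Series.

Section Partial.
Context {R : realType} {d : nat}.
Local Notation E := (R * 'rV[R]_d)%type.
Implicit Types (f : E -> R) (s : seq (option 'I_d)).

(* [None] is the direction of x and [Some i] that of y_i. *)
Definition axis (a : option 'I_d) : E :=
  if a is Some i then (0, delta_mx 0 i) else (1, 0).

(* The last direction of the list is differentiated first. *)
Definition pderivs s f : E -> R :=
  foldr (fun a (g : E -> R) => 'D_(axis a) g) f s.

Fixpoint pderivables s f : Prop :=
  if s is a :: s' then
    pderivables s' f /\ forall z : E, derivable (pderivs s' f) z (axis a)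
  else True.

Definition directions (l : nat) (j : 'I_d -> nat) : seq (option 'I_d) :=
  nseq l None ++ flatten [seq nseq (j i) (Some i) | i <- enum 'I_d].

Definition pderiv (l : nat) (j : 'I_d -> nat) f : E -> R :=
  pderivs (directions l j) f.

Definition has_pderiv (l : nat) (j : 'I_d -> nat) f : Prop :=
  pderivables (directions l j) f.

(* The lists [s] range over all orders of differentiation, so this is the usual
   class C^n; the bounds concern only the derivatives of order exactly n. *)
Definition Cn (n : nat) f : Prop :=
  (forall s, (size s <= n)%N -> pderivables s f /\ continuous (pderivs s f)) /\
  (forall (l : nat) (j : 'I_d -> nat), (l + \sum_i j i)%N = n ->
     bounded_fun (pderiv l j f) /\ unif_continuous (pderiv l j f)).

Definition supnorm f : \bar R := ereal_sup [set (`|f z|)%:E | z in [set: E]].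

End Partial.

Section Operator.
Context {R : realType} {d : nat}.
Local Notation E := (R * 'rV[R]_d)%type.
Local Notation mu := (@lebesgue_measure R).

Definition set_coord (v : 'rV[R]_d) (i : 'I_d) (t : R) : 'rV[R]_d :=
  \row_k (if k == i then t else v 0 k).

(* Integral over the box prod_i [a i, b i], as an iterated integral.  All
   coordinates of the base point 0 are overwritten. *)
Definition box_integral (a b : 'I_d -> R) (F : 'rV[R]_d -> R) : R :=
  foldr (fun i (G : 'rV[R]_d -> R) v =>
           \int[mu]_(t in `[a i, b i]) G (set_coord v i t))
        F (enum 'I_d) 0.

(* The multi-indices j with l + |j| <= n have all their entries in 0..n. *)
Definition hermite_mean (n : nat) (w : R) (f : E -> R) (z : E)
    (k : int) (m : 'rV[int]_d) : R :=
  \sum_(l < n.+1)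
   \sum_(j : {ffun 'I_d -> 'I_n.+1} | (l + \sum_i j i <= n)%N)
    ((l`! * \prod_i (j i)`!)%N%:R)^-1 * w ^+ d.+1 *
    \int[mu]_(u in `[k%:~R / w, (k%:~R + 1) / w])
      box_integral (fun i => (m 0 i)%:~R / w) (fun i => ((m 0 i)%:~R + 1) / w)
        (fun v => pderiv l (fun i => j i : nat) f (u, v) *
                  (z.1 - u) ^+ l * \prod_i (z.2 0 i - v 0 i) ^+ j i).

Definition kantorovich_term (n : nat) (w : R) (phi : R -> R)
    (psi : 'I_d -> R -> R) (f : E -> R) (z : E) (km : int * 'rV[int]_d) : R :=
  phi (w * z.1 - km.1%:~R) *
  (\prod_i psi i (w * z.2 0 i - (km.2 0 i)%:~R)) *
  hermite_mean n w f z km.1 km.2.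

(* The double series over k and m is one sum over the pairs (k, m). *)
Definition kantorovich (n : nat) (w : R) (phi : R -> R)
    (psi : 'I_d -> R -> R) (f : E -> R) (z : E) : R :=
  rsum (kantorovich_term n w phi psi f z).

End Operator.

(* Main.v *)
Require Import Defs.
From HB Require Import structures.
From mathcomp Require Import all_boot all_order all_algebra.
From mathcomp Require Import all_classical all_reals all_analysis.
From mathcomp Require Import ring lra zify.
Import Order.TTheory GRing.Theory Num.Theory.
Import numFieldNormedType.Exports.
Local Open Scope classical_set_scope.
Local Open Scope ring_scope.
Set Implicit Arguments.
Unset Strict Implicit.
Unset Printing Implicit Defensive.

(** The operator averages, over the cell of each node [k], the Taylor
    polynomials of order [n] of [f] expanded at the points of the cell, and
    combines these averages with the weights of a tensor product kernel.

    Differentiating a Taylor polynomial in the variable at which it is evaluated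
    gives the Taylor polynomial, of one order less, of the differentiated
    function ([is_derive_taylor]). A derivative of the series therefore falls
    either on the kernel, bringing out a factor [w], or on the Taylor factor,
    lowering its order. All series that occur have the same shape
    [series_sum w de be], with [de] derivatives on the kernel and [be] on the
    Taylor factor, and differentiating one of them gives the sum of two others
    ([is_derive_series_sum]). It remains to find the limit of each.

    In [series_sum w de be] the Taylor factor is the derivative [G be] of [f]
    at [z] plus an error. The first part contributes [G be z] times the sum of
    the integer translates of the kernel differentiated [de] times, which is
    [1] if [de] is zero and vanishes otherwise: the partition of unity may be
    differentiated termwise ([rsum_kernel_derive], [rsum_tensor_kernel]). As to
    the error, at a node whose distance to [w z] is [t] the remainder is at most
    a constant times [((1 + t) / w) ^+ (n - mideg be)] times the oscillation of
    the derivatives of order [n] ([taylor_remainder], [local_taylor_error]).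
    Since [de] and [be] have total degree at most [n], the negative power of [w]
    absorbs the factor [w ^+ mideg de], and the power of [1 + t] is controlled
    by the moments of order [n]. For [t] small compared with [w] the oscillation
    is small by uniform continuity; the other nodes carry a small part of the
    moments because these converge uniformly ([series_sum_cvg]). Induction on
    the list of directions concludes ([pderivs_series_sum]).

    The moments converge uniformly, but nothing dominates the series term by
    term, so that differentiation relies on uniformly small tails
    ([is_derive_rsum]). Passing from lists of directions to multi-indices rests
    on the symmetry of mixed derivatives ([schwarz]). *)

(** * Unordered sums *)

Section UnorderedSums.
Context {R : realType} {I : choiceType}.
Implicit Types (a b : I -> R) (s t : seq I) (B e : R).

(** Summability with an explicit bound: the bounds, not mere summability, have
    to be uniform in the parameters of the series. *)
Definition sum_bounded a B := forall s, uniq s -> \sum_(i <- s) `|a i| <= B.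

Lemma esum_le_seq (D : set I) a B :
  (forall s, uniq s -> (forall i, i \in s -> D i) -> \sum_(i <- s) a i <= B) ->
  (\esum_(i in D) (a i)%:E <= B%:E)%E.
Proof.
move=> h; apply: ge_ereal_sup => _ [X [finX XD] <-].
rewrite fsbig_finite//= sumEFin lee_fin.
apply: h => // i; rewrite in_fset_set// inE; exact: XD.
Qed.

Lemma seq_le_esum (D : set I) a s : uniq s -> (forall i, i \in s -> D i) ->
  ((\sum_(i <- s) a i)%:E <= \esum_(i in D) (a i)%:E)%E.
Proof.
move=> us sD; apply: esum_ge; exists [set` s]; first by split => // i /sD.
by rewrite -sumEFin fsbig_seq.
Qed.

Lemma sum_sub_split (a : I -> R) s t : uniq s -> uniq t -> {subset s <= t} ->
  \sum_(i <- t) a i =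
  \sum_(i <- s) a i + \sum_(i <- [seq i <- t | i \notin s]) a i.
Proof.
move=> us ut st; rewrite (bigID (mem s))/= [in RHS]big_filter.
rewrite -[X in X + _ = _]big_filter; congr (_ + _).
apply: perm_big; apply: uniq_perm; [exact: filter_uniq|by []|move=> i].
by rewrite mem_filter; case: (boolP (i \in s)) => //= /st ->.
Qed.

Lemma ler_sum_sub (a : I -> R) s t : (forall i, 0 <= a i) ->
  uniq s -> uniq t -> {subset s <= t} -> \sum_(i <- s) a i <= \sum_(i <- t) a i.
Proof.
by move=> a0 us ut st; rewrite (sum_sub_split _ us ut st) lerDl sumr_ge0.
Qed.

Lemma ge0_esum_approx a B : (forall i, 0 <= a i) ->
  (forall s, uniq s -> \sum_(i <- s) a i <= B) ->
  forall e, 0 < e -> exists2 s0, uniq s0 & forall s, uniq s ->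
    {subset s0 <= s} ->
    let S := fine (\esum_(i in setT) (a i)%:E) in
    S - e <= \sum_(i <- s) a i <= S.
Proof.
move=> a0 aB e e0.
have le : (\esum_(i in setT) (a i)%:E <= B%:E)%E by apply: esum_le_seq => s us _; exact: aB.
have ge : (0 <= \esum_(i in setT) (a i)%:E)%E.
  by apply: esum_ge0 => i _; rewrite lee_fin.
have fin : (\esum_(i in setT) (a i)%:E)%E \is a fin_num.
  by rewrite ge0_fin_numE// (le_lt_trans le)// ltry.
set S := fine _.
have [_ [X [finX _] <-]] : exists2 x,
    [set (\sum_(x \in A) (a x)%:E)%E | A in fsets [set: I]] x & ((S - e)%:E < x)%E.
  apply/ereal_sup_gt; rewrite -/(esum _ _) -(fineK fin) lte_fin -/S; lra.
rewrite fsbig_finite//= sumEFin lte_fin => lt.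
exists (finmap.enum_fset (fset_set X)); first exact: finmap.fset_uniq.
move=> s us sub; apply/andP; split.
  by apply: (le_trans (ltW lt)); apply: ler_sum_sub => //; exact: finmap.fset_uniq.
by rewrite -lee_fin /S fineK//; apply: seq_le_esum.
Qed.

Lemma sum_bounded_ge0 a B : sum_bounded a B -> 0 <= B.
Proof. by move=> /(_ [::] isT); rewrite big_nil. Qed.

Lemma sum_boundedW a b B : (forall i, `|b i| <= `|a i|) ->
  sum_bounded a B -> sum_bounded b B.
Proof. by move=> ba aB s us; apply: le_trans (aB s us); apply: ler_sum. Qed.

Lemma sum_boundedD a b A B : sum_bounded a A -> sum_bounded b B ->
  sum_bounded (fun i => a i + b i) (A + B).
Proof.
move=> aA bB s us; apply: le_trans (lerD (aA s us) (bB s us)).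
by rewrite -big_split/=; apply: ler_sum => i _; exact: ler_normD.
Qed.

Lemma sum_boundedZ k a A : sum_bounded a A ->
  sum_bounded (fun i => k * a i) (`|k| * A).
Proof.
move=> aA s us; under eq_bigr do rewrite normrM.
by rewrite -mulr_sumr ler_wpM2l// aA.
Qed.

Lemma sum_bounded_summable a B : sum_bounded a B -> summable setT (EFin \o a).
Proof.
move=> aB; rewrite /summable (le_lt_trans _ (ltry B))//.
rewrite (_ : (fun x => _) = (fun i => (`|a i|)%:E))//.
by apply: esum_le_seq => s us _; exact: aB.
Qed.

(** The defining property of an unordered sum; every other fact about [rsum]
    is read off from it. *)
Lemma rsum_approx a B : sum_bounded a B -> forall e, 0 < e ->
  exists2 s0, uniq s0 & forall s, uniq s -> {subset s0 <= s} ->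
    `|\sum_(i <- s) a i - rsum a| <= e.
Proof.
move=> aB e e0.
have e20 : 0 < e / 2 by lra.
have [||s1 us1 h1] := @ge0_esum_approx (fun i => Num.max (a i) 0) B _ _ _ e20.
- by move=> i; rewrite le_max lexx orbT.
- move=> s us; apply: le_trans (aB s us); apply: ler_sum => i _.
  by rewrite ge_max normr_ge0 ler_norm.
have [||s2 us2 h2] := @ge0_esum_approx (fun i => Num.max (- a i) 0) B _ _ _ e20.
- by move=> i; rewrite le_max lexx orbT.
- move=> s us; apply: le_trans (aB s us); apply: ler_sum => i _.
  by rewrite ge_max normr_ge0 -normrN ler_norm.
exists (undup (s1 ++ s2)) => [|s us sub]; first exact: undup_uniq.
have /(h1 s us)/= /andP[] : {subset s1 <= s}.
  by move=> i is1; apply: sub; rewrite mem_undup mem_cat is1.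
have /(h2 s us)/= /andP[] : {subset s2 <= s}.
  by move=> i is1; apply: sub; rewrite mem_undup mem_cat is1 orbT.
rewrite /rsum.
have -> : (\esum_(i in setT) ((EFin \o a)^\+)%E i)%E =
  (\esum_(i in setT) (Num.max (a i) 0)%:E)%E.
  by apply: eq_esum => i _; rewrite funeposE/= EFin_max.
have -> : (\esum_(i in setT) ((EFin \o a)^\-)%E i)%E =
  (\esum_(i in setT) (Num.max (- a i) 0)%:E)%E.
  by apply: eq_esum => i _; rewrite funenegE/= EFin_max.
have -> : \sum_(i <- s) a i = \sum_(i <- s) Num.max (a i) 0 - \sum_(i <- s) Num.max (- a i) 0.
  rewrite -sumrB; apply: eq_bigr => i _.
  by case: (leP (a i) 0); case: (leP (- a i) 0) => ??; lra.
set x := fine _; set y := fine _.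
move=> ????; rewrite ler_norml; apply/andP; split; lra.
Qed.

Lemma rsum_unique a B x : sum_bounded a B ->
  (forall e, 0 < e -> exists2 s0, uniq s0 & forall s, uniq s -> {subset s0 <= s} ->
    `|\sum_(i <- s) a i - x| <= e) -> rsum a = x.
Proof.
move=> aB h; apply/eqP; rewrite -subr_eq0 -normr_le0.
apply/ler_addgt0Pr => e e0; rewrite add0r.
have e20 : 0 < e / 2 by lra.
have [s1 us1 h1] := rsum_approx aB e20.
have [s2 us2 h2] := h _ e20.
have us : uniq (undup (s1 ++ s2)) by exact: undup_uniq.
have /(h1 _ us) : {subset s1 <= undup (s1 ++ s2)}.
  by move=> i is1; rewrite mem_undup mem_cat is1.
have /(h2 _ us) : {subset s2 <= undup (s1 ++ s2)}.
  by move=> i is1; rewrite mem_undup mem_cat is1 orbT.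
set S := \sum_(i <- _) _.
rewrite !ler_norml => /andP[A1 A2] /andP[A3 A4]; apply/andP; split; lra.
Qed.

Lemma rsum_le a B : sum_bounded a B -> `|rsum a| <= B.
Proof.
move=> aB; apply/ler_addgt0Pr => e e0.
have [s us h] := rsum_approx aB e0.
have := h _ us (fun _ => id); have := aB _ us.
have := ler_norm_sum s a xpredT.
set S := \sum_(i <- s) a i => h1 h2 h3.
have := ler_distD S 0 (rsum a); rewrite !sub0r !normrN => h4.
lra.
Qed.

Lemma rsumD a b A B : sum_bounded a A -> sum_bounded b B ->
  rsum (fun i => a i + b i) = rsum a + rsum b.
Proof.
move=> aA bB; apply: (rsum_unique (sum_boundedD aA bB)) => e e0.
have e20 : 0 < e / 2 by lra.
have [s1 us1 h1] := rsum_approx aA e20.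
have [s2 us2 h2] := rsum_approx bB e20.
exists (undup (s1 ++ s2)) => [|s us sub]; first exact: undup_uniq.
have {}h1 : `|\sum_(i <- s) a i - rsum a| <= e / 2.
  by apply: h1 => // i is1; apply: sub; rewrite mem_undup mem_cat is1.
have {}h2 : `|\sum_(i <- s) b i - rsum b| <= e / 2.
  by apply: h2 => // i is1; apply: sub; rewrite mem_undup mem_cat is1 orbT.
rewrite big_split/= opprD addrACA (le_trans (ler_normD _ _))//; lra.
Qed.

Lemma rsumZ k a A : sum_bounded a A -> rsum (fun i => k * a i) = k * rsum a.
Proof.
move=> aA; apply: (rsum_unique (sum_boundedZ k aA)) => e e0.
have k0 : 0 < `|k| + 1 by have := normr_ge0 k; lra.
have [s1 us1 h1] := rsum_approx aA (divr_gt0 e0 k0).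
exists s1 => // s us /(h1 _ us); rewrite ler_pdivlMr// => h.
rewrite -mulr_sumr -mulrBr normrM mulrC; apply: le_trans h.
by rewrite ler_wpM2l//; lra.
Qed.

Lemma rsumB a b A B : sum_bounded a A -> sum_bounded b B ->
  rsum (fun i => a i - b i) = rsum a - rsum b.
Proof.
move=> aA bB; rewrite -[- rsum b]mulN1r -(rsumZ (-1) bB) -(rsumD aA (sum_boundedZ (-1) bB)).
by congr rsum; apply/funext => i; rewrite mulN1r.
Qed.

Lemma rsum_tail a A s e : sum_bounded a A -> uniq s ->
  (forall t, uniq t -> (forall i, i \in t -> i \notin s) -> \sum_(i <- t) `|a i| <= e) ->
  `|rsum a - \sum_(i <- s) a i| <= e.
Proof.
move=> aA us h; apply/ler_addgt0Pr => r r0.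
have [s1 us1 h1] := rsum_approx aA r0.
set t := undup (s1 ++ s).
have ut : uniq t by exact: undup_uniq.
have st : {subset s <= t} by move=> i is1; rewrite mem_undup mem_cat is1 orbT.
have /(h1 t ut) : {subset s1 <= t}.
  by move=> i is1; rewrite mem_undup mem_cat is1.
rewrite (sum_sub_split _ us ut st).
have /(h _ (filter_uniq (fun i => i \notin s) ut)) :
    forall i, i \in [seq i <- t | i \notin s] -> i \notin s.
  by move=> i; rewrite mem_filter => /andP[].
have := ler_norm_sum [seq i <- t | i \notin s] a xpredT.
set S := \sum_(i <- s) _; set T := \sum_(i <- _) a i; set T' := \sum_(i <- _) _.
rewrite !ler_norml => /andP[A1 A2] A3 /andP[A4 A5]; apply/andP; split; lra.
Qed.

End UnorderedSums.

(** * Mean values and termwise differentiation *)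

Section TermwiseDerivative.
Context {R : realType}.

Lemma mean_value_le (f df : R -> R) (a b C : R) :
  (forall x, Num.min a b <= x <= Num.max a b ->
     is_derive x 1 f (df x) /\ `|df x| <= C) ->
  `|f b - f a| <= C * `|b - a|.
Proof.
wlog ab : a b / a <= b.
  move=> W h; case: (leP a b) => [ab|/ltW ba]; first exact: W.
  by rewrite distrC [`|b - a|]distrC; apply: W => //; rewrite minC maxC.
rewrite min_l// max_r// => h.
have [||x xab ->] := @MVT_segment _ f df a b ab.
- by move=> x; rewrite in_itv/= => /andP[/ltW ax /ltW xb]; apply h; rewrite ax.
- apply: derivable_within_continuous => x; rewrite in_itv/= => xab.
  by have [[]] := h _ xab.
by rewrite normrM ler_wpM2r//; apply h; move: xab; rewrite in_itv.
Qed.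

Lemma is_derive_affine (G : R -> R) (a b x d : R) :
  is_derive (a * x + b) 1 G d -> is_derive x 1 (fun y => G (a * y + b)) (a * d).
Proof.
move=> h.
have h2 : is_derive x 1 (fun y => a * y + b) a.
  have -> : (fun y => a * y + b) = (a \*: id + cst b : R -> R) by [].
  by apply: is_derive_eq; rewrite addr0 [_%:A]mulr1.
by rewrite mulrC; apply: (@is_derive1_comp _ G (fun y => a * y + b)).
Qed.

Lemma is_derive_mul (V : normedModType R) (f g : V -> R) (x v : V) (df dg : R) :
  is_derive x v f df -> is_derive x v g dg ->
  is_derive x v (fun y => f y * g y) (f x * dg + g x * df).
Proof. exact: is_deriveM. Qed.

Lemma is_derive_scale (V : normedModType R) (f : V -> R) (x v : V) (m df : R) :
  is_derive x v f df -> is_derive x v (fun y => m * f y) (m * df).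
Proof. exact: is_deriveZ. Qed.

Lemma is_derive_sum_seq (V : normedModType R) (I : eqType) (s : seq I)
    (F : I -> V -> R) (F' : I -> R) (x v : V) :
  (forall i, i \in s -> is_derive x v (F i) (F' i)) ->
  is_derive x v (fun y => \sum_(i <- s) F i y) (\sum_(i <- s) F' i).
Proof.
elim: s => [|i s IH] h.
  under [X in is_derive _ _ X]eq_fun do rewrite big_nil.
  by rewrite big_nil; exact: is_derive_cst.
under [X in is_derive _ _ X]eq_fun do rewrite big_cons.
rewrite big_cons; apply: is_deriveD; first by apply: h; rewrite mem_head.
by apply: IH => j js; apply: h; rewrite inE js orbT.
Qed.

(** The tails of the difference quotients are controlled by those of the
    derivatives: the mean value theorem is applied to finite sums, with signs,
    so that only the tails have to be uniformly small, not each term. *)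
Lemma is_derive_rsum (I : choiceType) (F F' : I -> R -> R) (r B : R) : 0 < r ->
  (forall (i : I) (x : R), `|x| < r -> is_derive x 1 (F i) (F' i x)) ->
  (forall x : R, `|x| < r -> sum_bounded (F ^~ x) B) ->
  (sum_bounded (F' ^~ 0) B) ->
  (forall e, 0 < e -> exists2 s0 : seq I, uniq s0 &
     forall x : R, `|x| < r -> forall t, uniq t -> (forall i, i \in t -> i \notin s0) ->
       \sum_(i <- t) `|F' i x| <= e) ->
  is_derive (0 : R) 1 (fun x => rsum (F ^~ x)) (rsum (F' ^~ 0)).
Proof.
move=> r0 dF bF bF' tail.
have r00 : `|0 : R| < r by rewrite normr0.
suff cv : (fun h => h^-1 *: (rsum (F ^~ (h *: 1 + 0)) - rsum (F ^~ 0))) @ 0^' -->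
  rsum (F' ^~ 0).
  by apply: DeriveDef; [apply: cvgP cv|apply: cvg_lim cv].
apply/cvgrPdist_le => e e0.
have e30 : 0 < e / 3 by lra.
have [s0 us0 hs0] := tail _ e30.
have [dS1 dS2] : is_derive (0 : R) 1 (fun x => \sum_(i <- s0) F i x) (\sum_(i <- s0) F' i 0).
  by apply: is_derive_sum_seq => i _; exact: dF.
have : (fun h => h^-1 *: (\sum_(i <- s0) F i (h *: 1 + 0) - \sum_(i <- s0) F i 0)) @ 0^' -->
  \sum_(i <- s0) F' i 0.
  by rewrite -dS2; exact: dS1.
move=> /cvgrPdist_le/(_ _ e30) near1.
have near2 : \forall h \near (0 : R)^', `|h| < r.
  by apply: dnbhs0_lt.
have near3 : \forall h \near (0 : R)^', h != 0.
  by exact: nbhs_dnbhs_neq.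
set S1 := \sum_(i <- s0) _ in near1; near=> h.
have hn0 : h != 0 by near: h.
have hr : `|h| < r by near: h.
have : `|S1 - h^-1 *: (\sum_(i <- s0) F i (h *: 1 + 0) - \sum_(i <- s0) F i 0)| <= e / 3.
  by near: h.
rewrite /S1; have -> : h *: 1 + 0 = h :> R by rewrite addr0 [_ *: _]mulr1.
set S := \sum_(i <- s0) F i h; set S0 := \sum_(i <- s0) F i 0; set S' := \sum_(i <- s0) _.
move=> H1.
have H2 : `|rsum (F' ^~ 0) - S'| <= e / 3.
  by apply: (rsum_tail bF' us0) => t ut tn; apply: hs0.
have H3 : `|rsum (fun i => F i h - F i 0) - \sum_(i <- s0) (F i h - F i 0)| <= e / 3 * `|h|.
  have bb : sum_bounded (fun i => F i h - F i 0) (B + `|-1| * B).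
    have := sum_boundedD (bF h hr) (sum_boundedZ (-1) (bF 0 r00)).
    by congr sum_bounded; apply/funext => i; rewrite mulN1r.
  apply: (rsum_tail bb us0) => t ut tn.
  (* With signs, the sum of absolute values is an increment of one function. *)
  pose sg i := Num.sg (F i h - F i 0).
  have -> : \sum_(i <- t) `|F i h - F i 0| =
     \sum_(i <- t) sg i * F i h - \sum_(i <- t) sg i * F i 0.
    by rewrite -sumrB; apply: eq_bigr => i _; rewrite -mulrBr normrEsg.
  apply: le_trans (ler_norm _) _.
  have -> : `|h| = `|h - 0| by rewrite subr0.
  apply: (@mean_value_le (fun x => \sum_(i <- t) sg i * F i x)
     (fun x => \sum_(i <- t) sg i * F' i x)) => x xh.
  have xr : `|x| < r.
    apply: le_lt_trans hr; move: xh; rewrite ler_norml.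
    by case: (leP 0 h) => h0 /andP[? ?]; rewrite ?(ger0_norm h0) ?(ltr0_norm h0);
      apply/andP; split; lra.
  split.
    apply: (@is_derive_sum_seq _ _ t (fun i x => sg i * F i x)
      (fun i => sg i * F' i x)) => i _.
    exact: is_derive_scale (dF i x xr).
  apply: le_trans (hs0 x xr t ut tn).
  apply: le_trans (ler_norm_sum _ _ _) _; apply: ler_sum => i _.
  by rewrite normrM ler_piMl// normr_sg; case: (_ != 0).
have E1 : rsum (fun i => F i h - F i 0) = rsum (F^~ h) - rsum (F^~0).
  exact: (rsumB (bF h hr) (bF 0 r00)).
rewrite E1 sumrB -/S -/S0 in H3.
set X := rsum (F^~ h) - _ in H3 *; set Y := S - S0 in H1 H3.
have H4 : `|h^-1 *: X - h^-1 *: Y| <= e / 3.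
  rewrite -scalerBr normrZ normfV mulrC ler_pdivrMr ?normr_gt0//.
move: H1 H2 H4; rewrite !ler_norml => /andP[? ?]/andP[? ?]/andP[? ?].
apply/andP; split; lra.
Unshelve. all: by end_near.
Qed.

End TermwiseDerivative.

(** * Moments of a kernel over the integers *)

Section Moments.
Context {R : realType}.
Implicit Types (g : R -> R) (s : seq int).

(** The weight is what a Taylor remainder of order at most [n] costs at
    distance [`|u - k|] from the node, the [1] accounting for the size of the
    cell; being at least [1], it also dominates all lower powers. *)
Definition moment_term (n : nat) g (u : R) (k : int) : R :=
  (1 + `|u - k%:~R|) ^+ n * `|g (u - k%:~R)|.

Lemma moment_term_ge0 n g u k : 0 <= moment_term n g u k.
Proof. by rewrite mulr_ge0// exprn_ge0// addr_ge0. Qed.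

(** Beyond distance [1] the weights [1 + t] and [t] are comparable. *)
Lemma moment_tail n g : uniformly_convergent_moment n g ->
  forall e, 0 < e -> exists2 r : R, 1 <= r & forall u s, uniq s ->
    (forall k, k \in s -> r <= `|u - k%:~R|) ->
    \sum_(k <- s) moment_term n g u k <= e.
Proof.
move=> [_ h] e e0.
have e20 : 0 < e / 2 ^+ n by rewrite divr_gt0// exprn_gt0.
have /h[M [_ hM]] := @nbhs_open_ereal_lt _ 0 (fun=> e / 2 ^+ n) e20.
exists (Num.max M 1 + 1); first by rewrite lerDr// le_max ler01 orbT.
move=> u s us hs.
have /hM /= : M < Num.max M 1 + 1.
  by rewrite (@le_lt_trans _ _ (Num.max M 1)) ?ltrDl// le_max lexx.
set r := Num.max M 1 + 1 => lt.
have r1 : 1 <= r by rewrite lerDr// le_max ler01 orbT.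
have : \sum_(k <- s) `|u - k%:~R| ^+ n * `|g (u - k%:~R)| <= e / 2 ^+ n.
  rewrite -lee_fin; apply: le_trans (ltW lt).
  apply: (@le_trans _ _ (\esum_(k in [set k : int | (r <= `|u - k%:~R|)%R])
               (`|u - k%:~R| ^+ n * `|g (u - k%:~R)|)%:E)%E).
    exact: seq_le_esum.
  by apply: ereal_sup_ubound; exists u.
rewrite ler_pdivlMr ?exprn_gt0//; apply: le_trans.
rewrite mulr_suml !big_seq; apply: ler_sum => k ks.
rewrite /moment_term mulrAC ler_wpM2r// -exprMn lerXn2r// ?nnegrE ?mulr_ge0 ?addr_ge0//.
have := le_trans r1 (hs k ks); lra.
Qed.

(** Only boundedly many integers lie within a fixed distance of a point, so
    uniform tails together with boundedness bound the whole moment. *)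
Lemma moment_bounded n g C : uniformly_convergent_moment n g ->
  (forall x, `|g x| <= C) ->
  exists B, forall u s, uniq s -> \sum_(k <- s) moment_term n g u k <= B.
Proof.
move=> gn gC; have [r r1 hr] := moment_tail gn ltr01.
have C0 : 0 <= C by rewrite (le_trans _ (gC 0)).
pose N := (Num.truncn (r + r + 1)).+1.
exists (N%:R * ((1 + r) ^+ n * C) + 1) => u s us.
rewrite (bigID (fun k : int => `|u - k%:~R| < r))/= lerD//; last first.
  rewrite -big_filter; apply: hr; first exact: filter_uniq.
  by move=> k; rewrite mem_filter -leNgt => /andP[].
rewrite -big_filter; set t := [seq k <- s | _].
apply: (@le_trans _ _ (\sum_(k <- t) ((1 + r) ^+ n * C))).
  rewrite !big_seq; apply: ler_sum => k; rewrite mem_filter => /andP[kr _].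
  rewrite /moment_term ler_pM// ?exprn_ge0 ?addr_ge0// lerXn2r// ?nnegrE ?addr_ge0//; lra.
rewrite big_const_seq count_predT iter_addr_0 -[leLHS]mulr_natl ler_wpM2r//.
  by rewrite mulr_ge0// exprn_ge0//; lra.
rewrite ler_nat.
pose k0 := Num.floor (u - r).
rewrite -(size_iota 0 N) -(size_map (fun i : nat => k0 + i%:Z)).
apply: uniq_leq_size; first exact: filter_uniq.
move=> k; rewrite mem_filter ltr_distl => /andP[/andP[k1 k2] _].
have k0k : k0 <= k.
  rewrite -(ler_int R); apply: (le_trans (floor_le_tmp _)); lra.
apply/mapP; exists `|k - k0|%N; last by rewrite gez0_abs ?subr_ge0// (addrC k0) addrNK.
rewrite mem_iota/= add0n ltnS /N.
have N0 : 0 <= r + r + 1 by lra.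
rewrite truncn_ge_nat//.
rewrite -[_%:R]/(`|k - k0|%N%:~R) gez0_abs ?subr_ge0// intrB.
have : u - r < k0%:~R + 1.
  by rewrite -[1]/(1%:~R) -intrD -floor_lt_int ltrDl.
lra.
Qed.

Lemma kernel_moment n (g : R -> R) l : Cb n g -> kernel_of_order n g ->
  (forall l, (1 <= l <= n)%N -> uniformly_convergent_moment n (g^`(l))%classic) ->
  (l <= n)%N ->
  uniformly_convergent_moment n (g^`(l))%classic /\
  exists C, forall x, `|(g^`(l))%classic x| <= C.
Proof.
move=> [_ gb] [_ gu _] gM ln; split.
  by case: l ln => [|l] ln; [exact: gu|apply: gM].
have [_ [M [_ hM]]] := gb l ln.
by exists (M + 1) => x; apply: (hM (M + 1)); rewrite ?ltrDl.
Qed.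

Definition ints (N : nat) : seq int :=
  [seq i%:Z - N%:Z | i <- iota 0 (N + N).+1].

Lemma ints_uniq N : uniq (ints N).
Proof. by rewrite map_inj_uniq ?iota_uniq// => i j /addIr[]. Qed.

Lemma mem_ints N (k : int) : (k \in ints N) = (`|k| <= N)%N.
Proof.
apply/mapP/idP => [[i]|kN]; first by rewrite mem_iota => ? ->; lia.
by exists (absz (k + N%:Z)); [rewrite mem_iota|]; lia.
Qed.

Lemma far_ints (u r : R) : exists N, forall k, k \notin ints N ->
  r + 1 <= `|u - k%:~R|.
Proof.
exists (Num.truncn (`|u| + `|r| + 1)).+1 => k; rewrite mem_ints -ltnNge => h.
have : `|u| + `|r| + 1 < `|k%:~R : R|.
  rewrite -intr_norm -[`|k|]/(Posz `|k|%N) -[(Posz _)%:~R]/(`|k|%N%:R : R).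
  by apply: lt_trans (truncnS_gt _) _; rewrite ltr_nat.
have := ler_distD u 0 k%:~R; rewrite !sub0r !normrN.
have := ler_norm r; lra.
Qed.

Lemma moment_sum_bounded n g B :
  (forall u s, uniq s -> \sum_(k <- s) moment_term n g u k <= B) ->
  forall u, sum_bounded (fun k : int => g (u - k%:~R)) B.
Proof.
move=> h u s us; apply: le_trans (h u s us); apply: ler_sum => k _.
by rewrite ler_peMl// exprn_ege1// lerDl.
Qed.

(** Differentiating the partition of unity termwise. *)
Lemma rsum_kernel_derive n (g : R -> R) l : Cb n g -> kernel_of_order n g ->
  (forall l, (1 <= l <= n)%N -> uniformly_convergent_moment n (g^`(l))%classic) ->
  (l <= n)%N -> forall u,
  rsum (fun k : int => (g^`(l))%classic (u - k%:~R)) = (l == 0%N)%:R.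
Proof.
move=> gC gK gM; elim: l => [|l IH] ln u; first by case: gK.
have [gl [C0 hC0]] := kernel_moment gC gK gM (ltnW ln).
have [B0 hB0] := moment_bounded gl hC0.
have [gl1 [C1 hC1]] := kernel_moment gC gK gM ln.
have [B1 hB1] := moment_bounded gl1 hC1.
have dF (k : int) (x : R) : is_derive x 1 (fun y => g^`(l)%classic (u + y - k%:~R))
     (g^`(l.+1)%classic (u + x - k%:~R)).
  have -> : (fun y => g^`(l)%classic (u + y - k%:~R)) =
     (fun y => g^`(l)%classic (1 * y + (u - k%:~R))).
    by apply/funext => y; congr (g^`(l)%classic _); ring.
  rewrite -[g^`(l.+1)%classic _]mul1r; apply: is_derive_affine.
  rewrite derive1nS derive1E.
  have -> : u + x - k%:~R = 1 * x + (u - k%:~R) by ring.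
  by apply: derivableP; case: gC => + _; apply.
have := @is_derive_rsum R int (fun k y => g^`(l)%classic (u + y - k%:~R))
  (fun k y => g^`(l.+1)%classic (u + y - k%:~R)) 1 (Num.max B0 B1) ltr01.
case => //.
- move=> x _ s us; rewrite le_max (moment_sum_bounded hB0)//.
- by move=> s us; rewrite le_max (moment_sum_bounded hB1 _ us) orbT.
- move=> e e0; have [r r1 hr] := moment_tail gl1 e0.
  have [N hN] := far_ints u r.
  exists (ints N); first exact: ints_uniq.
  move=> x x1 t ut tn.
  apply: le_trans (hr (u + x) t ut _); last first.
    move=> k /tn /hN h; have := ler_distD (u + x) u k%:~R.
    rewrite opprD addrA subrr sub0r normrN; lra.
  apply: ler_sum => k _; rewrite ler_peMl// exprn_ege1// lerDl//.
- move=> _; rewrite addr0 => <-.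
  under eq_fun do rewrite IH ?(ltnW ln)//.
  by rewrite -[(fun=> _)]/(cst _) derive_cst.
Qed.

End Moments.

(** * Boxes of integer points and tensor products *)

Lemma big_option (R : Type) (idx : R) (op : Monoid.com_law idx) (T : finType)
    (F : option T -> R) :
  \big[op/idx]_(c : option T) F c = op (F None) (\big[op/idx]_(i : T) F (Some i)).
Proof.
rewrite (bigD1 None)//=; congr (op _ _).
by rewrite (reindex_omap Some id) => [|[]]//; apply: eq_bigl => i; rewrite eqxx.
Qed.

Section IntegerBoxes.
Context {R : realType} {d : nat}.
Local Notation Z := (int * 'rV[int]_d)%type.
Implicit Types (k : Z) (c : option 'I_d) (N : nat) (s : seq Z).

Definition zcoord k c : int := if c is Some i then k.2 0 i else k.1.

Definition zpoint N (g : {ffun option 'I_d -> 'I_(N + N).+1}) : Z :=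
  ((g None)%:Z - N%:Z, \row_i ((g (Some i))%:Z - N%:Z)).

(** Boxes are enumerated by finite functions so that distributivity turns the
    sum over a box of a product into a product of sums. *)
Definition zbox N : seq Z :=
  [seq zpoint g | g <- enum {: {ffun option 'I_d -> 'I_(N + N).+1}}].

Lemma zcoord_zpoint N (g : {ffun option 'I_d -> 'I_(N + N).+1}) c :
  zcoord (zpoint g) c = (g c)%:Z - N%:Z.
Proof. by case: c => [i|]//=; rewrite mxE. Qed.

Lemma zcoord_inj k k' : zcoord k =1 zcoord k' -> k = k'.
Proof.
case: k k' => [k m] [k' m'] e; congr pair; first exact: (e None).
by apply/rowP => i; exact: (e (Some i)).
Qed.

Lemma zbox_uniq N : uniq (zbox N).
Proof.
rewrite map_inj_uniq ?enum_uniq// => g h gh; apply/ffunP => c.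
have := congr1 (zcoord^~ c) gh; rewrite /= !zcoord_zpoint => /addIr[] gc.
exact: val_inj.
Qed.

Lemma mem_zbox N k : (k \in zbox N) = [forall c, zcoord k c \in ints N].
Proof.
apply/mapP/forallP => [[g _ ->] c|h].
  by rewrite zcoord_zpoint mem_ints; move: (nat_of_ord _) (ltn_ord (g c)) => x; lia.
have lt c : (absz (zcoord k c + N%:Z)%R < (N + N).+1)%N.
  by have := h c; rewrite mem_ints; lia.
exists [ffun c => Ordinal (lt c)]; first by rewrite mem_enum.
apply: zcoord_inj => c; rewrite zcoord_zpoint ffunE /=.
by have := h c; rewrite mem_ints; lia.
Qed.

Lemma sub_zbox s : exists N, {subset s <= zbox N}.
Proof.
exists (\max_(k <- s) \max_c `|zcoord k c|)%N => k ks.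
rewrite mem_zbox; apply/forallP => c; rewrite mem_ints.
apply: leq_trans (leq_bigmax_seq _ ks _) => //.
exact: (@leq_bigmax _ (fun c => `|zcoord k c|%N)).
Qed.

Lemma sum_zbox (a : option 'I_d -> int -> R) N :
  \sum_(k <- zbox N) \prod_c a c (zcoord k c) = \prod_c \sum_(i <- ints N) a c i.
Proof.
have -> : \prod_c \sum_(i <- ints N) a c i =
          \prod_c \sum_(i < (N + N).+1) a c (i%:Z - N%:Z).
  by apply: eq_bigr => c _; rewrite big_map -[iota _ _]/(index_iota 0 (N + N).+1) big_mkord.
rewrite bigA_distr_bigA big_map big_enum/=; apply: eq_bigr => g _.
by apply: eq_bigr => c _; rewrite zcoord_zpoint.
Qed.

(** Every finite set of integer points lies in a box, where the sum factors. *)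
Lemma sum_bounded_prod (a : option 'I_d -> int -> R) (B : option 'I_d -> R) :
  (forall c, sum_bounded (a c) (B c)) ->
  sum_bounded (fun k => \prod_c a c (zcoord k c)) (\prod_c B c).
Proof.
move=> aB s us; have [N sN] := sub_zbox s.
apply: (@le_trans _ _ (\sum_(k <- zbox N) \prod_c `|a c (zcoord k c)|)).
  under eq_bigr do rewrite normr_prod.
  by apply: ler_sum_sub => // [i|]; [exact: prodr_ge0|exact: zbox_uniq].
rewrite (sum_zbox (fun c i => `|a c i|)); apply: ler_prod => c _.
by rewrite sumr_ge0//= aB// ints_uniq.
Qed.

(** Splitting according to a coordinate at which [P] holds puts the smallness
    on a single factor. *)
Lemma sum_prod_tail (a : option 'I_d -> int -> R) (P : option 'I_d -> pred int) (B e : R) :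
  (forall c, sum_bounded (a c) B) ->
  (forall c (s : seq int), uniq s -> \sum_(i <- s | P c i) `|a c i| <= e) ->
  forall s, uniq s ->
  \sum_(k <- s | [exists c, P c (zcoord k c)]) `|\prod_c a c (zcoord k c)| <=
    d.+1%:R * (e * B ^+ d).
Proof.
move=> aB ae s us.
apply: (@le_trans _ _ (\sum_c \sum_(k <- s | P c (zcoord k c)) `|\prod_c a c (zcoord k c)|)).
  under [leRHS]eq_bigr do rewrite big_mkcond.
  rewrite exchange_big/= big_mkcond/=; apply: ler_sum => k _.
  case: existsP => [[c Pc]|_]; last by rewrite sumr_ge0// => c _; case: ifP.
  by rewrite [leRHS](bigD1 c)//= Pc lerDl sumr_ge0// => c' _; case: ifP.
have -> : d.+1%:R * (e * B ^+ d) = \sum_(c : option 'I_d) e * B ^+ d.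
  by rewrite sumr_const card_option card_ord mulr_natl.
apply: ler_sum => c _.
pose a' c' i := if c' == c then (P c i)%:R * a c i else a c' i.
pose B' c' := if c' == c then e else B.
have -> : e * B ^+ d = \prod_c' B' c'.
  rewrite (bigD1 c)//= /B' eqxx; congr (_ * _).
  rewrite (eq_bigr (fun=> B)); last by move=> c' /negbTE ->.
  rewrite prodr_const cardC1 card_option card_ord//.
have a'B' c' : sum_bounded (a' c') (B' c').
  move=> t ut; rewrite /a' /B'; case: eqP => [_|_]; last exact: aB.
  apply: le_trans (ae c t ut); rewrite [leRHS]big_mkcond; apply: ler_sum => i _.
  by case: (P c i); rewrite ?mul1r// mul0r normr0.
apply: le_trans (sum_bounded_prod a'B' us).
rewrite big_mkcond/=; apply: ler_sum => k _; case: ifP => // Pk.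
rewrite le_eqVlt; apply/orP; left; apply/eqP; congr `|_|; apply: eq_bigr => c' _.
by rewrite /a'; case: eqP => [->|//]; rewrite Pk mul1r.
Qed.

(** The factorization is exact on boxes, and the boxes exhaust the integer
    points. *)
Lemma rsum_prod (a : option 'I_d -> int -> R) (B : R) :
  (forall c, sum_bounded (a c) B) ->
  (forall c e, 0 < e -> exists N, forall s : seq int, uniq s ->
      \sum_(i <- s | i \notin ints N) `|a c i| <= e) ->
  rsum (fun k : Z => \prod_c a c (zcoord k c)) = \prod_c rsum (a c).
Proof.
move=> aB ae.
have mono c N M (s : seq int) e : (N <= M)%N -> uniq s ->
    (forall s : seq int, uniq s -> \sum_(i <- s | i \notin ints N) `|a c i| <= e) ->
    \sum_(i <- s | i \notin ints M) `|a c i| <= e.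
  move=> NM us h; apply: le_trans (h s us).
  rewrite [leLHS]big_mkcond [leRHS]big_mkcond; apply: ler_sum => i _.
  by rewrite !mem_ints -!ltnNge; case: ltnP => [Mi|_]; [rewrite (leq_ltn_trans NM)|case: ifP].
have c1 : (fun N => \prod_c \sum_(i <- ints N) a c i) @ \oo --> \prod_c rsum (a c).
  apply: cvg_big; first exact: mul_continuous.
  move=> c _; apply/cvgrPdist_le => e /(ae c)[N hN]; exists N => // M /= NM.
  apply: (rsum_tail (aB c)); first exact: ints_uniq.
  move=> t ut tM; apply: le_trans (mono c N M t e NM ut hN).
  by rewrite [leLHS]big_seq [leRHS]big_mkcond [leRHS]big_seq; apply: ler_sum => i /tM ->.
have c2 : (fun N => \prod_c \sum_(i <- ints N) a c i) @ \oo -->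
    rsum (fun k : Z => \prod_c a c (zcoord k c)).
  apply/cvgrPdist_le => e e0.
  have bB := sum_bounded_prod aB.
  have B0 := sum_bounded_ge0 (aB None).
  pose e' := e / (d.+1%:R * (B ^+ d + 1)).
  have B1 : 0 < B ^+ d + 1 by rewrite ltr_wpDl// exprn_ge0.
  have e'0 : 0 < e' by rewrite divr_gt0// mulr_gt0.
  have /choice[M hM] : forall c, exists N, forall s : seq int, uniq s ->
      \sum_(i <- s | i \notin ints N) `|a c i| <= e' by move=> c; exact: ae.
  exists (\max_c M c)%N => // N /= MN.
  rewrite -sum_zbox; apply: (rsum_tail bB); first exact: zbox_uniq.
  move=> t ut tN.
  have tail c (s : seq int) : uniq s -> \sum_(i <- s | i \notin ints N) `|a c i| <= e'.
    move=> us; apply: mono us (hM c).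
    by apply: leq_trans MN; exact: leq_bigmax.
  have := sum_prod_tail (P := fun c i => i \notin ints N) aB tail ut.
  rewrite big_mkcond => le; apply: (@le_trans _ _ (d.+1%:R * (e' * B ^+ d))).
    apply: le_trans le; rewrite !big_seq; apply: ler_sum => k /tN.
    by rewrite mem_zbox negb_forall => ->.
  have -> : e = d.+1%:R * (e' * (B ^+ d + 1)).
    by rewrite /e'; field; rewrite nat1r pnatr_eq0 gt_eqF.
  by rewrite ler_wpM2l// ler_wpM2l ?(ltW e'0)// lerDl.
exact: cvg_unique c2 c1.
Qed.

End IntegerBoxes.

(** * Symmetry of mixed derivatives *)

Section Derivatives.
Context {R : realType}.

(** Directional derivatives at all points of a line are the derivatives of one
    function of a real variable, to which the mean value theorem applies. *)
Lemma is_derive_line (V : normedModType R) (f : V -> R) (z v : V) (h D : R) :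
  is_derive h (1 : R) (fun t : R => f (t *: v + z)) D <->
  is_derive (h *: v + z) v f D.
Proof.
have e : (fun t : R => t^-1 *: (f ((t *: (1 : R) + h) *: v + z) - f (h *: v + z))) =
  (fun t : R => t^-1 *: (f (t *: v + (h *: v + z)) - f (h *: v + z))).
  by apply/funext => t; rewrite [_%:A]mulr1 scalerDl addrA.
split=> -[d1 d2]; apply: DeriveDef.
- by move: d1; rewrite /derivable e.
- by move: d2; rewrite /derive e.
- by rewrite /derivable e.
- by rewrite /derive e.
Qed.

Section Schwarz.
Context {V : normedModType R}.

(** The mean value theorem, first along [v], then along [w]. *)
Lemma second_difference (f f1 f12 : V -> R) (v w z : V) (h : R) : 0 < h ->
  (forall z, is_derive z v f (f1 z)) -> (forall z, is_derive z w f1 (f12 z)) ->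
  exists s t, [/\ 0 <= s <= h, 0 <= t <= h &
    f (h *: w + (h *: v + z)) - f (h *: v + z) - (f (h *: w + z) - f z) =
    h * h * f12 (t *: w + (s *: v + z))].
Proof.
move=> h0 d1 d2.
have dg (x : R) : is_derive x (1 : R) (fun x => f (x *: v + (h *: w + z)) - f (x *: v + z))
    (f1 (x *: v + (h *: w + z)) - f1 (x *: v + z)).
  by apply: is_deriveB; apply/is_derive_line.
have [|s sh E1] := @MVT_segment R _ _ 0 h (ltW h0) (fun x _ => dg x).
  by apply: derivable_within_continuous => x _; have [] := dg x.
have dk (x : R) : is_derive x (1 : R) (fun x => f1 (x *: w + (s *: v + z)))
    (f12 (x *: w + (s *: v + z))).
  by apply/is_derive_line.
have [|t th E2] := @MVT_segment R _ _ 0 h (ltW h0) (fun x _ => dk x).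
  by apply: derivable_within_continuous => x _; have [] := dk x.
exists s, t; split; [by move: sh; rewrite in_itv|by move: th; rewrite in_itv|].
move: E1 E2; rewrite !scale0r !add0r !subr0.
rewrite [h *: v + (h *: w + z)]addrCA => -> .
rewrite [s *: v + (h *: w + z)]addrCA => ->; ring.
Qed.

(** Both mixed derivatives are limits of the same second difference. *)
Lemma schwarz (f fv fw fvw fwv : V -> R) (v w z : V) :
  (forall z, is_derive z v f (fv z)) -> (forall z, is_derive z w fv (fvw z)) ->
  (forall z, is_derive z w f (fw z)) -> (forall z, is_derive z v fw (fwv z)) ->
  {for z, continuous fvw} -> {for z, continuous fwv} -> fvw z = fwv z.
Proof.
move=> dv dvw dw dwv cvw cwv.
apply/eqP; rewrite -subr_eq0 -normr_le0; apply/ler_addgt0Pr => e e0; rewrite add0r.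
have e20 : 0 < e / 2 by lra.
have key (g : V -> R) (x y : V) : {for z, continuous g} ->
    exists2 r : R, 0 < r & forall s t : R, 0 <= s <= r -> 0 <= t <= r ->
      `|g z - g (s *: x + (t *: y + z))| <= e / 2.
  move=> gz.
  have : (fun p : R * R => g (p.1 *: x + (p.2 *: y + z))) @ ((0 : R), (0 : R)) --> g z.
    have E : z = (0 : R) *: x + ((0 : R) *: y + z) by rewrite !scale0r !add0r.
    rewrite {2}E; apply: continuous_cvg; first by rewrite -E.
    apply: cvgD; [|apply: cvgD; last exact: cvg_cst]; apply: cvgZ (cvg_cst _).
      exact: cvg_fst.
    exact: cvg_snd.
  move=> /cvgrPdist_le/(_ _ e20)/nbhs_ballP[r /= r0 hr].
  exists (r / 2); first by lra.
  move=> s t ? ?; apply: (hr (s, t)); split; rewrite /ball/= sub0r normrN ger0_norm; lra.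
have [r r0 hr] := key fvw w v cvw.
have [q q0 hq] := key fwv v w cwv.
pose h := Num.min r q.
have h0 : 0 < h by rewrite lt_min r0.
have [s [t [sh th E1]]] := second_difference z h0 dv dvw.
have [s' [t' [sh' th' E2]]] := second_difference z h0 dw dwv.
have hlr : h <= r by rewrite ge_min lexx.
have hlq : h <= q by rewrite ge_min lexx orbT.
have A1 := hr t s _ _; have A2 := hq t' s' _ _.
have : fvw (t *: w + (s *: v + z)) = fwv (t' *: v + (s' *: w + z)).
  apply: (mulfI (mulf_neq0 (lt0r_neq0 h0) (lt0r_neq0 h0))).
  rewrite -E1 -E2 [h *: v + (h *: w + z)]addrCA; ring.
move: A1 A2; rewrite !ler_norml => A1 A2 E.
have /andP[? ?] : - (e / 2) <= fvw z - fvw (t *: w + (s *: v + z)) <= e / 2 by apply: A1; lra.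
have /andP[? ?] : - (e / 2) <= fwv z - fwv (t' *: v + (s' *: w + z)) <= e / 2 by apply: A2; lra.
apply/andP; split; lra.
Qed.

End Schwarz.

End Derivatives.

(** * Multi-indices and partial derivatives *)

Section Coordinates.
Context {R : realType} {d : nat}.
Local Notation E := (R * 'rV[R]_d)%type.
Local Notation A := (option 'I_d).
Implicit Types (z : E) (c a : A) (s : seq A) (f g : E -> R).

(** Indexing the first variable by [None] lets all variables be treated
    alike. *)
Definition coord z c : R := if c is Some i then z.2 0 i else z.1.

Lemma coord_inj z z' : coord z =1 coord z' -> z = z'.
Proof.
case: z z' => [x y] [x' y'] e; congr pair; first exact: (e None).
by apply/rowP => i; exact: (e (Some i)).
Qed.

Lemma coord_axis a c : coord (axis a) c = (c == a)%:R.
Proof.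
by case: a c => [i|] [j|]//=; rewrite mxE ?eqxx//= eq_sym.
Qed.

Lemma coord_line h a z c : coord (h *: axis a + z) c = h * (c == a)%:R + coord z c.
Proof. by rewrite -coord_axis; case: c => [i|]//=; rewrite !mxE. Qed.

Lemma ball_coord z (e : R) z' : 0 < e -> (forall c, `|coord z c - coord z' c| < e) -> ball z e z'.
Proof.
move=> e0 h; split; first exact: (h None).
by split => // i j; rewrite ord1; exact: (h (Some j)).
Qed.

Lemma coord_ball z (e : R) z' c : ball z e z' -> `|coord z c - coord z' c| < e.
Proof. by case: c => [i|] [h1] h2 //=; case: h2 => _; apply. Qed.

Lemma coord_continuous c : continuous (coord^~ c).
Proof.
move=> z; apply/cvgrPdist_lt => e e0; near=> z'; apply: coord_ball; near: z'.
exact: (@nbhsx_ballx R (R * 'rV[R]_d)%type z e e0).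
Unshelve. all: by end_near. Qed.

Definition incr (al : A -> nat) a : A -> nat := fun c => (al c + (c == a))%N.
Definition mideg (al : A -> nat) : nat := (\sum_c al c)%N.

Lemma mideg_incr al a : mideg (incr al a) = (mideg al).+1.
Proof.
rewrite /mideg /incr big_split/= -addn1; congr (_ + _)%N.
by rewrite (bigD1 a)//= eqxx big1// => c /negbTE ->.
Qed.

Lemma midegE al : mideg al = (al None + \sum_i al (Some i))%N.
Proof. exact: big_option. Qed.

(** One list among all those that contain each direction [c] exactly [al c]
    times; for a function of class C^n they all give the same derivative, up
    to order [n]. *)
Definition midirs (al : A -> nat) : seq A := directions (al None) (fun i => al (Some i)).

Lemma count_midirs al c : count_mem c (midirs al) = al c.
Proof.
rewrite count_cat count_nseq count_flatten -map_comp sumnE big_map big_enum/=.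
case: c => [i|]/=.
  rewrite mul0n (bigD1 i)//= count_nseq/= eqxx mul1n big1 ?addn0// => j /negbTE ji.
  by rewrite count_nseq/= (inj_eq (@Some_inj _)) ji mul0n.
by rewrite mul1n big1 ?addn0// => j _; rewrite count_nseq/= mul0n.
Qed.

Lemma perm_midirs_incr al a : perm_eq (a :: midirs al) (midirs (incr al a)).
Proof.
rewrite /perm_eq; apply/allP => c _ /=.
by rewrite !count_midirs /incr addnC [a == c]eq_sym.
Qed.

Lemma size_midirs al : size (midirs al) = mideg al.
Proof.
rewrite size_cat size_nseq size_flatten /shape -map_comp sumnE big_map big_enum/= midegE.
by congr (_ + _)%N; apply: eq_bigr => i _; rewrite /= size_nseq.
Qed.

Lemma pderivables_cat s1 s2 f : pderivables (s1 ++ s2) f <->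
  pderivables s2 f /\ pderivables s1 (pderivs s2 f).
Proof.
elim: s1 => [|a s1 IH]/=; first by split=> [|[]].
rewrite IH; split=> [[[? ?] ?]|[? [? ?]]]; do ?split => //.
  by rewrite /pderivs -foldr_cat.
by rewrite /pderivs foldr_cat.
Qed.

Lemma pderivs_cat s1 s2 f : pderivs (s1 ++ s2) f = pderivs s1 (pderivs s2 f).
Proof. exact: foldr_cat. Qed.

Lemma pderivsD s f g : pderivables s f -> pderivables s g ->
  pderivables s (fun z => f z + g z) /\
  pderivs s (fun z => f z + g z) = (fun z => pderivs s f z + pderivs s g z).
Proof.
elim: s => [|a s IH]//= [sf df] [sg dg].
have [h1 h2] := IH sf sg; split.
  by split => // z; rewrite h2; apply: derivableD.
by apply/funext => z; rewrite h2; exact: deriveD.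
Qed.

Section SymmetricDerivatives.
Variables (n : nat) (f : E -> R).
Hypothesis fC : forall s, (size s <= n)%N -> pderivables s f /\ continuous (pderivs s f).

Lemma is_derive_pderivs a s z : (size s < n)%N ->
  is_derive z (axis a) (pderivs s f) (pderivs (a :: s) f z).
Proof. by move=> sn; apply: derivableP; have [/= [_ +] _] := @fC (a :: s) sn; apply. Qed.

Lemma pderivs_swap a b s : (size s <= n - 2)%N -> (1 < n)%N ->
  pderivs (a :: b :: s) f = pderivs (b :: a :: s) f.
Proof.
move=> sn n1; apply/funext => z.
apply: (@schwarz R E (pderivs s f) (pderivs (b :: s) f) (pderivs (a :: s) f) _ _ (axis b) (axis a)).
- by move=> x; apply: is_derive_pderivs; lia.
- by move=> x; apply: is_derive_pderivs => /=; lia.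
- by move=> x; apply: is_derive_pderivs; lia.
- by move=> x; apply: is_derive_pderivs => /=; lia.
- by have [_ +] := @fC (a :: b :: s) ltac:(rewrite /=; lia); apply.
- by have [_ +] := @fC (b :: a :: s) ltac:(rewrite /=; lia); apply.
Qed.

Lemma pderivs_front a s1 s2 : (size (s1 ++ a :: s2) <= n)%N ->
  pderivs (s1 ++ a :: s2) f = pderivs (a :: s1 ++ s2) f.
Proof.
elim: s1 => [|b s1 IH]//= sn.
rewrite /pderivs/= -/(pderivs _ f) IH; last by lia.
rewrite size_cat/= in sn.
by apply: (@pderivs_swap b a (s1 ++ s2)); rewrite ?size_cat; lia.
Qed.

Lemma pderivs_perm s t : perm_eq s t -> (size s <= n)%N -> pderivs s f = pderivs t f.
Proof.
elim: s t => [|a s IH] t; first by rewrite perm_sym => /perm_nilP ->.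
move=> st; have := perm_mem st a; rewrite mem_head => /esym at_.
move: st; case/splitPr: at_ => t1 t2.
move=> st sn; have sz := perm_size st.
have {}st : perm_eq s (t1 ++ t2).
  rewrite -(perm_cons a); apply: perm_trans st _.
  exact: (permEl (perm_catCA t1 [:: a] t2)).
rewrite pderivs_front; last by rewrite -sz.
by rewrite /pderivs/= -!/(pderivs _ f) (IH _ st)//; rewrite /= in sn; lia.
Qed.

(** Symmetry allows the derivatives up to order [n] to be indexed by
    multi-indices instead of lists of directions. *)
Lemma is_derive_midirs al a z : (mideg al < n)%N ->
  is_derive z (axis a) (pderivs (midirs al) f) (pderivs (midirs (incr al a)) f z).
Proof.
move=> an; have := is_derive_pderivs a (s := midirs al) z.
rewrite size_midirs => /(_ an); congr is_derive.
by rewrite (pderivs_perm (perm_midirs_incr al a))//= size_midirs.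
Qed.

End SymmetricDerivatives.

End Coordinates.

(** * Iterated integrals over boxes *)

Section IteratedIntegral.
Context {R : realType} {d : nat}.
Local Notation E := (R * 'rV[R]_d)%type.
Local Notation A := (option 'I_d).
Local Notation mu := (@lebesgue_measure R).
Implicit Types (z : E) (c : A) (s : seq A) (F G : E -> R).

(** A displacement along an axis rather than an overwritten entry, so that its
    continuity is that of the vector space operations. *)
Definition update z c (t : R) : E := (t - coord z c) *: axis c + z.

Lemma coord_update z c t c' : coord (update z c t) c' = if c' == c then t else coord z c'.
Proof.
by rewrite coord_line; case: eqP => [->|_]; rewrite ?mulr1 ?subrK// mulr0 add0r.
Qed.

Lemma update_continuous c : continuous (fun p : E * R => update p.1 c p.2).
Proof.
move=> p; apply: cvgD; last exact: cvg_fst.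
apply: cvgZ (cvg_cst _); apply: cvgB; first exact: cvg_snd.
apply: (@continuous_cvg _ _ _ _ _ fst (coord^~ c)); first exact: coord_continuous.
exact: cvg_fst.
Qed.

Variables a b : A -> R.
Hypothesis ab : forall c, a c < b c.

Definition integral1 c F : E -> R := fun z => \int[mu]_(t in `[a c, b c]) F (update z c t).

Definition iterated_integral s F : E -> R := foldr integral1 F s.

Lemma integrable_update c F z : continuous F ->
  mu.-integrable `[a c, b c] (EFin \o (fun t => F (update z c t))).
Proof.
move=> Fc; apply: continuous_compact_integrable; first exact: segment_compact.
suff h : continuous (fun t : R => F (update z c t)) by apply: continuous_subspaceT.
move=> t.
apply: (@continuous_cvg _ _ _ _ _ (fun t => update z c t) F); first exact: Fc.
apply: cvgD; last exact: cvg_cst.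
by apply: cvgZ (cvg_cst _); apply: cvgB; [exact: cvg_id|exact: cvg_cst].
Qed.

Lemma integral1_cst c k : integral1 c (cst k) = cst (k * (b c - a c)).
Proof.
apply/funext => z; rewrite /integral1 /cst Rintegral_cst//; congr (_ * _).
by have := lebesgue_measure_itv `[a c, b c]; rewrite /= lte_fin ab => ->.
Qed.

Lemma integral1_le c F z C : continuous F ->
  (forall t, a c <= t <= b c -> `|F (update z c t)| <= C) ->
  `|integral1 c F z| <= C * (b c - a c).
Proof.
move=> Fc FC; have Fi := integrable_update c z Fc.
apply: le_trans (le_normr_Rintegral _ Fi) _ => //.
have := integral1_cst c C; move=> /(congr1 (fun g => g z)) /= <-.
apply: le_Rintegral => //.
- exact: (integrable_norm Fi).
- exact: (@integrable_update c (cst C) z (fun x => cvg_cst _)).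
Qed.

Lemma integral1D c F G : continuous F -> continuous G ->
  integral1 c (fun z => F z + G z) = (fun z => integral1 c F z + integral1 c G z).
Proof. by move=> Fc Gc; apply/funext => z; apply: RintegralD => //; apply: integrable_update. Qed.

Lemma integral1Z c k F : continuous F ->
  integral1 c (fun z => k * F z) = (fun z => k * integral1 c F z).
Proof. by move=> Fc; apply/funext => z; apply: RintegralZl => //; apply: integrable_update. Qed.

(** The integrand varies continuously with the parameters, uniformly over the
    compact segment of integration. *)
Lemma integral1_continuous c F : continuous F -> continuous (integral1 c F).
Proof.
move=> Fc z; apply/cvgrPdist_le => e e0.
have ba0 : 0 < b c - a c by rewrite subr_gt0 ab.
have e'0 : 0 < e / (b c - a c) / 2 by rewrite !divr_gt0.
have Hc : continuous (fun p : E * R => F (update p.1 c p.2)).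
  move=> p; apply: (@continuous_comp (E * R)%type E R
    (fun p : E * R => update p.1 c p.2) F); last exact: Fc.
  exact: update_continuous.
suff cover : \forall z' \near z, `[a c, b c] `<=`
    (fun t => `|F (update z c t) - F (update z' c t)| <= e / (b c - a c)).
  apply: filterS cover => z' /= h.
  rewrite /integral1 -RintegralB//; [|exact: integrable_update..].
  have ii : mu.-integrable `[a c, b c] (EFin \o (fun t => F (update z c t) - F (update z' c t))).
    by have := integrableB _ (integrable_update c z Fc) (integrable_update c z' Fc); apply.
  apply: le_trans (le_normr_Rintegral _ ii) _ => //.
  apply: (@le_trans _ _ (\int[mu]_(t in `[a c, b c]) (e / (b c - a c)))); last first.
    have := integral1_cst c (e / (b c - a c)); move=> /(congr1 (fun g => g z)).
    by rewrite /integral1 /cst => ->; rewrite divfK// gt_eqF.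
  apply: le_Rintegral => //; first exact: (integrable_norm ii).
  exact: (@integrable_update c (cst (e / (b c - a c))) z (fun x => cvg_cst _)).
have /compact_near_coveringP cov := @segment_compact R (a c) (b c).
apply: (cov E (nbhs z)
  (fun z' t => `|F (update z c t) - F (update z' c t)| <= e / (b c - a c))) => t _.
have /cvgrPdist_le/(_ _ e'0)[[U V] /= [Uz Vt] UV] :
    (fun p : E * R => F (update p.1 c p.2)) @ (z, t) --> F (update z c t).
  exact: (Hc (z, t)).
exists (V, U) => // -[t' z'] /= [Vt' Uz'].
have /= A1 := UV (z, t') (conj (nbhs_singleton Uz) Vt').
have /= A2 := UV (z', t') (conj Uz' Vt').
move: A1 A2; rewrite distrC => A1 A2.
have := ler_distD (F (update z c t)) (F (update z c t')) (F (update z' c t')).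
lra.
Qed.

Lemma iterated_integral_continuous s F : continuous F -> continuous (iterated_integral s F).
Proof. by move=> Fc; elim: s => //= c s IH; exact: integral1_continuous. Qed.

Lemma iterated_integralD s F G : continuous F -> continuous G ->
  iterated_integral s (fun z => F z + G z) =
  (fun z => iterated_integral s F z + iterated_integral s G z).
Proof.
move=> Fc Gc; elim: s => //= c s ->.
by rewrite integral1D//; apply: iterated_integral_continuous.
Qed.

Lemma iterated_integralZ s k F : continuous F ->
  iterated_integral s (fun z => k * F z) = (fun z => k * iterated_integral s F z).
Proof.
by move=> Fc; elim: s => //= c s ->; rewrite integral1Z//; apply: iterated_integral_continuous.
Qed.

Lemma iterated_integral_cst s k :
  iterated_integral s (cst k) = cst (k * \prod_(c <- s) (b c - a c)).
Proof.
elim: s => /= [|c s ->]; first by rewrite big_nil mulr1.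
by rewrite integral1_cst big_cons -mulrA [X in _ * X]mulrC.
Qed.

(** The coordinates in [s] of the base point are arbitrary: integration
    overwrites them. *)
Lemma iterated_integral_le s F C z : continuous F ->
  (forall z', (forall c, a c <= coord z' c <= b c) -> `|F z'| <= C) ->
  (forall c, c \notin s -> a c <= coord z c <= b c) ->
  `|iterated_integral s F z| <= C * \prod_(c <- s) (b c - a c).
Proof.
move=> Fc FC; elim: s z => [|c s IH] z zs /=.
  by rewrite big_nil mulr1; apply: FC => c; exact: zs.
rewrite big_cons [X in _ * X]mulrC mulrA; apply: integral1_le.
  exact: iterated_integral_continuous.
move=> t tc; apply: IH => c' c's; rewrite coord_update; case: eqP => [->//|cc'].
by apply: zs; rewrite inE negb_or c's andbT; exact/eqP.
Qed.

End IteratedIntegral.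

Section BoxIntegral.
Context {R : realType} {d : nat}.
Local Notation E := (R * 'rV[R]_d)%type.
Local Notation A := (option 'I_d).
Local Notation mu := (@lebesgue_measure R).

Definition all_axes : seq A := None :: [seq Some i | i <- enum 'I_d].

Lemma mem_all_axes c : c \in all_axes.
Proof. by case: c => [i|]; rewrite inE//= mem_map ?mem_enum//; exact: Some_inj. Qed.

Lemma big_all_axes (T : Type) (idx : T) (op : Monoid.com_law idx) (F : A -> T) :
  \big[op/idx]_(c <- all_axes) F c = \big[op/idx]_c F c.
Proof. by rewrite big_cons big_map big_enum big_option. Qed.

Lemma box_integralE (a b : A -> R) (F : E -> R) :
  \int[mu]_(u in `[a None, b None])
     box_integral (fun i => a (Some i)) (fun i => b (Some i)) (fun v => F (u, v)) =
  iterated_integral a b all_axes F 0.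
Proof.
rewrite /all_axes /=; apply: eq_Rintegral => u _.
rewrite /box_integral.
have -> : update 0 None u = (u, 0) :> E.
  by apply: coord_inj => -[i|]; rewrite coord_update//= mxE.
elim: (enum _) (0 : 'rV_d) => //= i s IH v.
apply: eq_Rintegral => t _; rewrite IH; congr (iterated_integral _ _ _ _ _).
by apply: coord_inj => -[j|]; rewrite coord_update//= mxE.
Qed.

End BoxIntegral.

(** * Taylor polynomials under a linear functional *)

Section PolynomialFunctional.
Context {R : realType} {d : nat}.
Local Notation E := (R * 'rV[R]_d)%type.
Local Notation A := (option 'I_d).
Implicit Types (F K X : E -> R) (c a : A).

(** Evaluation at a point and averaging over a cell are both of this kind, so
    that Taylor polynomials and their averages are differentiated by the same
    argument. *)
Definition linear_on_continuous (L : (E -> R) -> R) : Prop :=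
  (forall F K, continuous F -> continuous K -> L (fun z => F z + K z) = L F + L K) /\
  (forall k F, continuous F -> L (fun z => k * F z) = k * L F).

Lemma continuousM_fun F K : continuous F -> continuous K -> continuous (fun z => F z * K z).
Proof. by move=> Fc Kc z; apply: cvgM; [exact: Fc|exact: Kc]. Qed.

Lemma continuousX_fun F k : continuous F -> continuous (fun z => F z ^+ k).
Proof.
move=> Fc; elim: k => [|k IH]; first by move=> z; exact: cvg_cst.
under [X in continuous X]eq_fun do rewrite exprS.
exact: continuousM_fun.
Qed.

Lemma continuous_prod (I : finType) (P : pred I) (F : I -> E -> R) :
  (forall i, continuous (F i)) -> continuous (fun z => \prod_(i | P i) F i z).
Proof.
by move=> Fc z; apply: cvg_big; [exact: mul_continuous|move=> i _; exact: Fc].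
Qed.

(** The powers of [h] can be pulled out of [L], so that the function of [h] is
    a polynomial: no limit is exchanged with [L], which is only linear. *)
Lemma is_derive_functional_power L K X k : linear_on_continuous L ->
  continuous K -> continuous X ->
  is_derive (0 : R) (1 : R) (fun h : R => L (fun z => K z * (h + X z) ^+ k))
    (k%:R * L (fun z => K z * X z ^+ k.-1)).
Proof.
move=> [LD LZ] + Xc; elim: k K => [|k IH] K Kc.
  rewrite mul0r; suff -> : (fun h : R => L (fun z => K z * (h + X z) ^+ 0)) = cst (L K).
    exact: is_derive_cst.
  by apply/funext => h; congr L; apply/funext => z; rewrite expr0 mulr1.
have hX (h : R) : continuous (fun z => h + X z).
  by move=> z; apply: cvgD; [exact: cvg_cst|exact: Xc].
have KX := continuousM_fun Kc Xc.
have -> : (fun h : R => L (fun z => K z * (h + X z) ^+ k.+1)) =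
  (fun h : R => h * L (fun z => K z * (h + X z) ^+ k) +
     L (fun z => (K z * X z) * (h + X z) ^+ k)).
  apply/funext => h; rewrite -LZ; last exact/continuousM_fun/continuousX_fun.
  rewrite -LD; last 2 first.
  - apply: continuousM_fun; first by move=> z; exact: cvg_cst.
    exact/continuousM_fun/continuousX_fun.
  - exact/continuousM_fun/continuousX_fun.
  by congr L; apply/funext => z; rewrite exprS; ring.
have d1 := IH _ Kc; have d2 := IH _ KX.
apply: is_derive_eq.
rewrite [_%:A]mulr1 /= [0 *: _]mul0r add0r.
have -> : L (fun z => K z * (0 + X z) ^+ k) = L (fun z => K z * X z ^+ k).
  by congr L; apply/funext => z; rewrite add0r.
case: k {IH d1 d2} => [|k]/=; first by rewrite mul0r addr0 mul1r.
have -> : L (fun z => K z * X z * X z ^+ k) = L (fun z => K z * X z ^+ k.+1).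
  by congr L; apply/funext => z; rewrite exprS mulrA.
rewrite -[k.+2%:R]nat1r; ring.
Qed.

Variables (n : nat) (G : (A -> nat) -> E -> R).
Local Notation MI := {ffun A -> 'I_n.+1}.

(** Sums need a finite index type, arithmetic does not: the multi-indices in
    the sums have entries at most [n], and [mi] forgets this bound. *)
Definition mi (g : MI) : A -> nat := fun c => g c.
Definition mi_add (al be : A -> nat) : A -> nat := fun c => (al c + be c)%N.
Definition mi_fact (al : A -> nat) : nat := (\prod_c (al c)`!)%N.
Definition monomial (al : A -> nat) (z ze : E) : R :=
  \prod_c (coord z c - coord ze c) ^+ al c.

(** The Taylor polynomial of order [m] of the derivative [G be], with the
    evaluation of its coefficients at the expansion point replaced by the
    functional [L]: evaluation gives the classical polynomial, averaging over
    a box gives the local factor of the operator. *)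
Definition taylor (L : (E -> R) -> R) (m : nat) (be : A -> nat) (z : E) : R :=
  \sum_(g : MI | (mideg (mi g) <= m)%N)
    (mi_fact (mi g))%:R^-1 * L (fun ze => G (mi_add be (mi g)) ze * monomial (mi g) z ze).

Hypothesis Gc : forall al, (mideg al <= n)%N -> continuous (G al).

Lemma mideg_add al be : mideg (mi_add al be) = (mideg al + mideg be)%N.
Proof. exact: big_split. Qed.

Lemma coord_sub_continuous (x : R) c : continuous (fun ze : E => x - coord ze c).
Proof. by move=> ze; apply: cvgB; [exact: cvg_cst|exact: coord_continuous]. Qed.

Lemma monomial_continuous al z : continuous (monomial al z).
Proof.
apply: continuous_prod => c; exact/continuousX_fun/coord_sub_continuous.
Qed.

Lemma taylor_term_continuous m be (g : MI) z : (mideg be + m <= n)%N ->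
  (mideg (mi g) <= m)%N ->
  continuous (fun ze => G (mi_add be (mi g)) ze * monomial (mi g) z ze).
Proof.
move=> bm gm; apply: continuousM_fun; last exact: monomial_continuous.
by apply: Gc; rewrite mideg_add; lia.
Qed.

Definition mi_up a (g : MI) : MI := [ffun c => inord (g c + (c == a))].
Definition mi_down a (g : MI) : MI := [ffun c => inord (g c - (c == a))].

Lemma mi_up_incr a (g : MI) : (g a < n)%N -> mi (mi_up a g) = incr (mi g) a.
Proof.
move=> ga; apply/funext => c; rewrite /mi /mi_up /incr ffunE inordK//.
by case: eqP => [->|_]; [rewrite addn1 ltnS|rewrite addn0 ltn_ord].
Qed.

Lemma leq_mideg al a : (al a <= mideg al)%N.
Proof. by rewrite /mideg (bigD1 a)//= leq_addr. Qed.

(** Multi-indices of degree at most [m.+1] that charge [a] are the successors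
    in direction [a] of those of degree at most [m]. *)
Lemma sum_mi_up a m (F : (A -> nat) -> R) : (m < n)%N ->
  \sum_(g : MI | (mideg (mi g) <= m.+1)%N && (0 < g a)%N) F (mi g) =
  \sum_(g : MI | (mideg (mi g) <= m)%N) F (incr (mi g) a).
Proof.
move=> mn; rewrite (reindex_onto (mi_up a) (mi_down a)) /=; last first.
  move=> g /andP[_ ga]; apply/ffunP => c; apply: val_inj; rewrite !ffunE /=.
  have lt : (g c - (c == a) < n.+1)%N by rewrite (leq_ltn_trans (leq_subr _ _)).
  rewrite (inordK lt) subnK ?inordK//.
  by case: eqP => // ->.
apply: eq_big => g.
  have [ga|ga] := ltnP (g a) n.
    rewrite mi_up_incr// mideg_incr ltnS.
    have -> : (0 < mi_up a g a)%N.
      by have := congr1 (fun f => f a) (mi_up_incr ga); rewrite /mi /incr eqxx => ->; rewrite addn1.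
    rewrite andbT; suff -> : mi_down a (mi_up a g) = g by rewrite eqxx andbT.
    apply/ffunP => c; apply: val_inj; rewrite /mi_down ffunE.
    have := congr1 (fun f => f c) (mi_up_incr ga); rewrite /mi /incr => ->.
    by rewrite addnK; exact: inordK (ltn_ord _).
  have an : (g a : nat) = n by apply/eqP; rewrite eqn_leq ga andbT -ltnS ltn_ord.
  have -> : (0 < mi_up a g a)%N = false.
    by rewrite /mi_up ffunE eqxx addn1 an /inord val_insubd ltnn.
  rewrite andbF; apply/esym/negbTE; rewrite -ltnNge (leq_trans mn)//.
  by rewrite -an; exact: leq_mideg.
move=> /andP[/andP[_ up0] _].
rewrite mi_up_incr// ltnNge; apply/negP => ng.
have an : (g a : nat) = n by apply/eqP; rewrite eqn_leq ng andbT -ltnS ltn_ord.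
by move: up0; rewrite /mi_up ffunE eqxx addn1 an /inord val_insubd ltnn.
Qed.

Lemma is_derive_sum_pred (V : normedModType R) (I : finType) (P : pred I)
    (F : I -> V -> R) (F' : I -> R) (x v : V) :
  (forall i, P i -> is_derive x v (F i) (F' i)) ->
  is_derive x v (fun y => \sum_(i | P i) F i y) (\sum_(i | P i) F' i).
Proof.
move=> h; rewrite -big_filter; under [X in is_derive _ _ X]eq_fun do rewrite -big_filter.
by apply: is_derive_sum_seq => i; rewrite mem_filter => /andP[/h].
Qed.

Lemma is_derive_taylor_term L al a (K : E -> R) z :
  linear_on_continuous L -> continuous K ->
  is_derive z (axis a) (fun z => L (fun ze => K ze * monomial al z ze))
    ((al a)%:R * L (fun ze => K ze * ((\prod_(c | c != a) (coord z c - coord ze c) ^+ al c)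
       * (coord z a - coord ze a) ^+ (al a).-1))).
Proof.
move=> Ll Kc.
have -> : z = (0 : R) *: axis a + z by rewrite scale0r add0r.
apply/is_derive_line.
pose K' ze := K ze * \prod_(c | c != a) (coord z c - coord ze c) ^+ al c.
have K'c : continuous K'.
  apply: continuousM_fun => //; apply: continuous_prod => c.
  exact/continuousX_fun/coord_sub_continuous.
have := @is_derive_functional_power L K' (fun ze => coord z a - coord ze a) (al a) Ll K'c
  (@coord_sub_continuous _ _).
congr (is_derive _ _ _ _).
  apply/funext => h; congr L; apply/funext => ze.
  rewrite /K' /monomial [in RHS](bigD1 a)//= -mulrA; congr (_ * _); rewrite mulrC; congr (_ * _).
    by rewrite coord_line eqxx mulr1 addrA.
  by apply: eq_bigr => c ca; rewrite coord_line (negbTE ca) mulr0 add0r.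
rewrite scale0r add0r; congr (_ * _); congr L; apply/funext => ze.
by rewrite /K' mulrA.
Qed.

(** The exponent brought down by the derivative cancels one factor of the
    factorial, and what remains is indexed by the predecessors in direction
    [a]. *)
Lemma is_derive_taylor L m be a z : linear_on_continuous L -> (mideg be + m.+1 <= n)%N ->
  is_derive z (axis a) (taylor L m.+1 be) (taylor L m (incr be a) z).
Proof.
move=> Ll bm.
pose T al := (mi_fact al)%:R^-1 * ((al a)%:R * L (fun ze => G (mi_add be al) ze *
   ((\prod_(c | c != a) (coord z c - coord ze c) ^+ al c)
       * (coord z a - coord ze a) ^+ (al a).-1))).
have -> : taylor L m (incr be a) z = \sum_(g : MI | (mideg (mi g) <= m.+1)%N) T (mi g).
  rewrite (bigID (fun g : MI => (0 < g a)%N))/= [X in _ + X]big1 ?addr0; last first.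
    by move=> g /andP[_]; rewrite lt0n negbK /T /mi => /eqP ->; rewrite mul0r mulr0.
  rewrite sum_mi_up; last by lia.
  apply: eq_bigr => g _; rewrite /T.
  set al := mi g.
  have inca : incr al a a = (al a).+1 by rewrite /incr eqxx addn1.
  have incc c : c != a -> incr al a c = al c by move=> /negbTE ca; rewrite /incr ca addn0.
  rewrite mulrA; congr (_ * L _).
    have -> : mi_fact (incr al a) = ((al a).+1 * mi_fact al)%N.
      rewrite /mi_fact [LHS](bigD1 a)//= [in RHS](bigD1 a)//= inca factS -mulnA.
      congr (_ * (_ * _))%N; by apply: eq_bigr => c /incc ->.
    by rewrite inca natrM invfM mulrAC mulVf ?mul1r// pnatr_eq0.
  apply/funext => ze; congr (_ * _).
    by congr G; apply/funext => c; rewrite /mi_add /incr addnCA addnA addnC addnA.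
  rewrite /monomial (bigD1 a)//= mulrC inca; congr (_ * _).
  by apply: eq_bigr => c /incc ->.
apply: is_derive_sum_pred => g gm.
apply: is_deriveZ; apply: is_derive_taylor_term => //.
by apply: Gc; rewrite mideg_add; lia.
Qed.

End PolynomialFunctional.

(** * The Taylor remainder *)

Section TaylorRemainder.
Context {R : realType} {d : nat}.
Local Notation E := (R * 'rV[R]_d)%type.
Local Notation A := (option 'I_d).
Implicit Types (F K X : E -> R) (c a : A).

Definition in_cube (ze : E) (r : R) (z : E) := forall c, `|coord z c - coord ze c| <= r.

(** Walk from the centre of the cube to [z] along the axes: the path stays in
    the cube and has one segment per coordinate. *)
Lemma increment_cube F (F' : A -> E -> R) (ze : E) (r C : R) :
  (forall z a, is_derive z (axis a) F (F' a z)) ->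
  (forall z a, in_cube ze r z -> `|F' a z| <= C) ->
  forall z, in_cube ze r z -> `|F z - F ze| <= d.+1%:R * r * C.
Proof.
move=> dF bF.
suff walk s z : in_cube ze r z -> (forall c, c \notin s -> coord z c = coord ze c) ->
    `|F z - F ze| <= (size s)%:R * (r * C).
  move=> z zr; have := walk (@all_axes d) z zr.
  rewrite /= size_map size_enum_ord mulrA; apply=> c.
  by rewrite mem_all_axes.
elim: s z => [|a s IH] z zr zs.
  by rewrite mul0r (_ : z = ze) ?subrr ?normr0//; apply: coord_inj => c; exact: zs.
pose z' := update z a (coord ze a).
have z'c c : coord z' c = if c == a then coord ze a else coord z c by rewrite coord_update.
have z'r : in_cube ze r z'.
  move=> c; rewrite z'c; case: eqP => [->|_]; last exact: zr.
  by rewrite subrr normr0 (le_trans _ (zr a)).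
have {}IH : `|F z' - F ze| <= (size s)%:R * (r * C).
  apply: IH => // c cs; rewrite z'c; case: eqP => [->//|/eqP ca].
  by apply: zs; rewrite inE negb_or ca.
have C0 : 0 <= C by rewrite (le_trans _ (bF z a zr)).
have step : `|F z - F z'| <= r * C.
  have E1 : z = (coord z a) *: axis a + update z a 0.
    apply: coord_inj => c; rewrite coord_line coord_update.
    by case: eqP => [->|_]; rewrite ?mulr1 ?addr0// mulr0 add0r.
  have E2 : z' = (coord ze a) *: axis a + update z a 0.
    apply: coord_inj => c; rewrite z'c coord_line coord_update.
    by case: eqP => _; rewrite ?mulr1 ?addr0// mulr0 add0r.
  rewrite {1}E1 E2.
  apply: (@le_trans _ _ (C * `|coord z a - coord ze a|)); last first.
    by rewrite mulrC ler_wpM2r.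
  apply: (@mean_value_le R (fun t => F (t *: axis a + update z a 0))
     (fun t => F' a (t *: axis a + update z a 0))) => x xb; split.
    by apply/is_derive_line.
  apply: bF => c; rewrite coord_line coord_update.
  case: eqP => [->|_]; rewrite ?mulr1 ?addr0 ?mulr0 ?add0r//.
  have := zr a; rewrite !ler_distl; move: xb; rewrite ge_min le_max.
  by move=> /andP[/orP[?|?]/orP[?|?]] /andP[? ?]; apply/andP; split; lra.
have := ler_distD (F z') (F z) (F ze).
rewrite [size _]/= -nat1r mulrDl mul1r => le; apply: le_trans le _; exact: lerD.
Qed.

Variables (n : nat) (G : (A -> nat) -> E -> R).
Local Notation MI := {ffun A -> 'I_n.+1}.
Hypothesis Gc : forall al, (mideg al <= n)%N -> continuous (G al).
Hypothesis Gd : forall al a z, (mideg al < n)%N ->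
  is_derive z (axis a) (G al) (G (incr al a) z).

Definition evaluation (ze : E) : (E -> R) -> R := fun F => F ze.

Lemma evaluation_linear ze : linear_on_continuous (evaluation ze).
Proof. by []. Qed.

Lemma taylor_center m be ze : taylor n G (evaluation ze) m be ze = G be ze.
Proof.
pose g0 : MI := [ffun=> ord0].
have g0c c : mi g0 c = 0%N by rewrite /mi ffunE.
have dg0 : mideg (mi g0) = 0%N by apply: big1 => c _; exact: g0c.
rewrite /taylor (bigD1 g0) ?dg0//= big1 ?addr0; last first.
  move=> g /andP[_ gg0].
  have /existsP[c gc] : [exists c, g c != ord0].
    apply: contraNT gg0; rewrite negb_exists => /forallP h.
    apply/eqP/ffunP => c; rewrite ffunE; apply/eqP.
    by have := h c; rewrite negbK.
  rewrite /evaluation /monomial (bigD1 c)//= subrr expr0n.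
  by rewrite (_ : mi g c == 0%N = false) ?mul0r ?mulr0//; apply/negbTE.
rewrite /evaluation /monomial big1 ?mulr1; last by move=> c _; rewrite g0c expr0.
rewrite /mi_fact big1 ?invr1 ?mul1r; last by move=> c _; rewrite g0c.
by congr (G _ _); apply/funext => c; rewrite /mi_add g0c addn0.
Qed.

(** Differentiating the remainder in any direction gives the remainder of one
    order less of the differentiated function, so the bound follows by
    induction on the order, each step costing one walk across the cube. *)
Lemma taylor_remainder ze (r om : R) :
  (forall al xi, mideg al = n -> in_cube ze r xi -> `|G al xi - G al ze| <= om) ->
  forall m be z, (mideg be + m)%N = n -> in_cube ze r z ->
  `|G be z - taylor n G (evaluation ze) m be z| <= (d.+1%:R * r) ^+ m * om.
Proof.
move=> Gom; elim=> [|m IH] be z bm zr.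
  rewrite expr0 mul1r.
  suff -> : taylor n G (evaluation ze) 0 be z = G be ze.
    by apply: Gom => //; rewrite -bm addn0.
  rewrite -(taylor_center 0 be); apply: eq_bigr => g; rewrite leqn0 => /eqP g0.
  have gc c : mi g c = 0%N by apply/eqP; rewrite -leqn0 -g0 leq_mideg.
  congr (_ * (_ * _)); apply: eq_bigr => c _; by rewrite gc !expr0.
pose Rem z := G be z - taylor n G (evaluation ze) m.+1 be z.
have -> : G be z - taylor n G (evaluation ze) m.+1 be z = Rem z - Rem ze.
  by rewrite /Rem taylor_center subrr subr0.
rewrite exprS -mulrA.
apply: (@increment_cube Rem (fun a z =>
  G (incr be a) z - taylor n G (evaluation ze) m (incr be a) z)) => //.
  move=> y a; apply: is_deriveB; first by apply: Gd; lia.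
  apply: (is_derive_taylor Gc); first exact: evaluation_linear.
  by lia.
by move=> y a yr; apply: IH => //; rewrite mideg_incr; lia.
Qed.

Lemma linear_on_continuous_sum (I : Type) (s : seq I) (P : pred I)
    (L : (E -> R) -> R) (k : I -> R) (F : I -> E -> R) :
  linear_on_continuous L -> (forall i, P i -> continuous (F i)) ->
  L (fun z => \sum_(i <- s | P i) k i * F i z) = \sum_(i <- s | P i) k i * L (F i).
Proof.
move=> [LD LZ] Fc.
have L0 : L (fun=> 0) = 0.
  rewrite -[RHS](mul0r (L (fun=> 0))) -(LZ 0 (fun=> 0) (fun z => cvg_cst _)).
  by congr L; apply/funext => z; rewrite mul0r.
have kFc i : P i -> continuous (fun z => k i * F i z).
  by move=> Pi; apply: continuousM_fun; [move=> z; exact: cvg_cst|exact: Fc].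
suff [] : L (fun z => \sum_(i <- s | P i) k i * F i z) = \sum_(i <- s | P i) k i * L (F i) /\
  continuous (fun z => \sum_(i <- s | P i) k i * F i z) by [].
elim: s => [|i s [IH1 IH2]].
  have -> : (fun z => \sum_(i <- [::] | P i) k i * F i z) = (fun=> 0).
    by apply/funext => z; rewrite big_nil.
  by rewrite big_nil; split => // z; exact: cvg_cst.
case: (boolP (P i)) => Pi.
  have -> : (fun z => \sum_(i <- i :: s | P i) k i * F i z) =
     (fun z => k i * F i z + \sum_(i <- s | P i) k i * F i z).
    by apply/funext => z; rewrite big_cons Pi.
  rewrite big_cons Pi; split; last by move=> z; apply: cvgD; [exact: kFc|exact: IH2].
  by rewrite LD ?LZ ?IH1//; [exact: Fc|exact: kFc].
have -> : (fun z => \sum_(i <- i :: s | P i) k i * F i z) =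
     (fun z => \sum_(i <- s | P i) k i * F i z).
  by apply/funext => z; rewrite big_cons (negbTE Pi).
by rewrite big_cons (negbTE Pi).
Qed.

(** A functional commutes with the Taylor sum: averaging the coefficients is
    averaging the Taylor polynomial over its expansion point. *)
Lemma taylorE L m be z : linear_on_continuous L -> (mideg be + m <= n)%N ->
  taylor n G L m be z = L (fun ze => taylor n G (evaluation ze) m be z) /\
  continuous (fun ze => taylor n G (evaluation ze) m be z).
Proof.
move=> Ll bm.
have tc (g : MI) : (mideg (mi g) <= m)%N ->
    continuous (fun ze => G (mi_add be (mi g)) ze * monomial (mi g) z ze).
  exact: (taylor_term_continuous Gc).
split.
  rewrite /taylor /evaluation.
  by rewrite (linear_on_continuous_sum _ (fun g : MI => (mi_fact (mi g))%:R^-1) Ll tc).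
move=> ze; rewrite /taylor /evaluation.
apply: cvg_big => [|g gm]; first exact: add_continuous.
 apply: cvgM; [exact: cvg_cst|exact: tc].
Qed.

End TaylorRemainder.

(** * Tensor product kernels *)

Lemma uniform_witness (R : realType) (T : finType) (P : T -> R -> Prop) :
  (forall t r r', r <= r' -> P t r -> P t r') ->
  (forall t, exists r, P t r) -> exists r, forall t, P t r.
Proof.
move=> mono /choice[r hr]; exists (\sum_t `|r t|) => t.
apply: mono (hr t); rewrite (le_trans (ler_norm _))//.
by rewrite (bigD1 t)//= lerDl sumr_ge0.
Qed.

Section TensorKernels.
Context {R : realType} {d n : nat}.
Local Notation A := (option 'I_d).
Local Notation Z := (int * 'rV[int]_d)%type.
Variable chi : A -> R -> R.
Hypothesis chiC : forall c, Cb n (chi c).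
Hypothesis chiK : forall c, kernel_of_order n (chi c).
Hypothesis chiM : forall c l, (1 <= l <= n)%N ->
  uniformly_convergent_moment n ((chi c)^`(l))%classic.
Implicit Types (c : A) (de : A -> nat) (u : A -> R) (e : R).

Definition kernel_derive de c : R -> R := ((chi c)^`(de c))%classic.

Definition tensor_moment de u (k : Z) : R :=
  \prod_c moment_term n (kernel_derive de c) (u c) (zcoord k c).

Lemma tensor_moment_ge0 de u k : 0 <= tensor_moment de u k.
Proof. by apply: prodr_ge0 => c _; exact: moment_term_ge0. Qed.

Lemma uniform_moment_bound : exists B, forall c l (u : R), (l <= n)%N ->
  sum_bounded (moment_term n ((chi c)^`(l))%classic u) B.
Proof.
have [t r r' rr' h u ln s us|[c l]|B hB] := @uniform_witness R (A * 'I_n.+1)%type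
  (fun t B => forall u : R, (t.2 <= n)%N ->
    sum_bounded (moment_term n ((chi t.1)^`(t.2))%classic u) B).
- by apply: le_trans rr'; exact: h.
- have ln : (l <= n)%N by rewrite -ltnS ltn_ord.
  have [gl [C hC]] := kernel_moment (chiC c) (chiK c) (chiM c) ln.
  have [B hB] := moment_bounded gl hC; exists B => u _ s us /=.
  under eq_bigr do rewrite ger0_norm ?moment_term_ge0//.
  exact: hB.
- exists B => c l u ln.
  have := hB (c, inord l) u; rewrite /= inordK//; exact.
Qed.

Lemma uniform_moment_tail e : 0 < e -> exists r : R,
  forall c l (u : R) (s : seq int), (l <= n)%N -> uniq s ->
    (forall k, k \in s -> r <= `|u - k%:~R|) ->
    \sum_(k <- s) moment_term n ((chi c)^`(l))%classic u k <= e.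
Proof.
move=> e0.
have [t r r' rr' h u s ln us ks|[c l]|r hr] := @uniform_witness R (A * 'I_n.+1)%type
  (fun t r => forall (u : R) (s : seq int), (t.2 <= n)%N -> uniq s ->
    (forall k, k \in s -> r <= `|u - k%:~R|) ->
    \sum_(k <- s) moment_term n ((chi t.1)^`(t.2))%classic u k <= e).
- by apply: h => // k /ks; exact: le_trans.
- have ln : (l <= n)%N by rewrite -ltnS ltn_ord.
  have [gl _] := kernel_moment (chiC c) (chiK c) (chiM c) ln.
  by have [r _ hr] := moment_tail gl e0; exists r => u s _; exact: hr.
- exists r => c l u s ln; have := hr (c, inord l) u s; rewrite /= inordK//; exact.
Qed.

Lemma tensor_moment_bounded : exists B, forall de u, (mideg de <= n)%N ->
  sum_bounded (tensor_moment de u) B.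
Proof.
have [B hB] := uniform_moment_bound; exists (\prod_(c : A) B) => de u den.
apply: (@sum_bounded_prod R d (fun c => moment_term n (kernel_derive de c) (u c)) (fun=> B)) => c.
by apply: hB; apply: leq_trans den; exact: leq_mideg.
Qed.

Lemma tensor_moment_tail e : 0 < e -> exists r : R,
  forall de u (P : A -> pred int) (s : seq Z),
  (mideg de <= n)%N -> (forall c i, P c i -> r <= `|u c - i%:~R|) -> uniq s ->
  \sum_(k <- s | [exists c, P c (zcoord k c)]) tensor_moment de u k <= e.
Proof.
move=> e0; have [B hB] := uniform_moment_bound.
have B0 : 0 <= B by exact: sum_bounded_ge0 (hB None 0%N 0 (leq0n n)).
pose e' := e / (d.+1%:R * (B ^+ d + 1)).
have B1 : 0 < B ^+ d + 1 by rewrite ltr_wpDl// exprn_ge0.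
have e'0 : 0 < e' by rewrite divr_gt0// mulr_gt0.
have [r hr] := uniform_moment_tail e'0; exists r => de u P s den hP us.
have lec c : (de c <= n)%N by apply: leq_trans den; exact: leq_mideg.
apply: (@le_trans _ _ (d.+1%:R * (e' * B ^+ d))); last first.
  have -> : e = d.+1%:R * (e' * (B ^+ d + 1)).
    by rewrite /e'; field; rewrite nat1r pnatr_eq0 gt_eqF.
  by rewrite ler_wpM2l// ler_wpM2l ?(ltW e'0)// lerDl.
under eq_bigr => k _ do rewrite -[tensor_moment _ _ _]ger0_norm ?tensor_moment_ge0//.
apply: (@sum_prod_tail R d (fun c => moment_term n (kernel_derive de c) (u c))) => //.
  by move=> c; exact: hB.
move=> c t ut; under eq_bigr => i _ do rewrite ger0_norm ?moment_term_ge0//.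
rewrite -big_filter; apply: hr => //; first exact: filter_uniq.
by move=> i; rewrite mem_filter => /andP[+ _]; exact: hP.
Qed.

Definition tensor_kernel de u (k : Z) : R :=
  \prod_c kernel_derive de c (u c - (zcoord k c)%:~R).

Lemma tensor_moment_factor de u k : tensor_moment de u k =
  (\prod_c (1 + `|u c - (zcoord k c)%:~R|)) ^+ n * `|tensor_kernel de u k|.
Proof.
by rewrite /tensor_moment /moment_term big_split/= prodrXl normr_prod.
Qed.

Lemma tensor_weight_ge1 u (k : Z) : 1 <= \prod_c (1 + `|u c - (zcoord k c)%:~R|).
Proof.
apply: (@le_trans _ _ (\prod_(c : A) (1 : R))); first by rewrite big1.
by apply: ler_prod => c _; rewrite ler01 lerDl normr_ge0.
Qed.

Lemma tensor_kernel_le de u k : `|tensor_kernel de u k| <= tensor_moment de u k.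
Proof. by rewrite tensor_moment_factor ler_peMl// exprn_ege1// tensor_weight_ge1. Qed.

Lemma tensor_kernel_bounded de u B : sum_bounded (tensor_moment de u) B ->
  sum_bounded (tensor_kernel de u) B.
Proof.
apply: sum_boundedW => k.
by rewrite [leRHS]ger0_norm ?tensor_moment_ge0//; exact: tensor_kernel_le.
Qed.

(** A factor that is differentiated at least once has integer translates that
    sum to [0], which annihilates the product. *)
Lemma rsum_tensor_kernel de u : (mideg de <= n)%N ->
  rsum (tensor_kernel de u) = (mideg de == 0%N)%:R.
Proof.
move=> den; have [B hB] := uniform_moment_bound.
have lec c : (de c <= n)%N by apply: leq_trans den; exact: leq_mideg.
have le1 c i : `|kernel_derive de c (u c - i%:~R)| <= moment_term n (kernel_derive de c) (u c) i.
  by rewrite ler_peMl// exprn_ege1// lerDl.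
rewrite (@rsum_prod R d (fun c i => kernel_derive de c (u c - i%:~R)) B).
- under eq_bigr do rewrite (rsum_kernel_derive (chiC _) (chiK _) (chiM _) (lec _)).
  case: eqP => [de0|/eqP de0].
    rewrite big1// => c _; suff -> : de c == 0%N by [].
    by rewrite -leqn0 -de0 leq_mideg.
  have /existsP[c dec] : [exists c, de c != 0%N].
    apply: contraNT de0; rewrite negb_exists => /forallP h.
    by apply/eqP; apply: big1 => c _; apply/eqP; have := h c; rewrite negbK.
  by rewrite (bigD1 c)//= (negbTE dec) mul0r.
- move=> c s us; apply: le_trans (hB c (de c) (u c) (lec c) s us).
  by apply: ler_sum => i _; rewrite [leRHS]ger0_norm ?moment_term_ge0//; exact: le1.
move=> c e e0; have [r hr] := uniform_moment_tail e0.
have [N hN] := far_ints (u c) r; exists N => s us.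
apply: (@le_trans _ _ (\sum_(i <- s | i \notin ints N) moment_term n (kernel_derive de c) (u c) i)).
  by apply: ler_sum => i _; exact: le1.
rewrite -big_filter; apply: hr => //; first exact: filter_uniq.
by move=> i; rewrite mem_filter => /andP[/hN + _]; lra.
Qed.

End TensorKernels.

(** * Averages over the cells of the grid *)

Section BoxAverage.
Context {R : realType} {d : nat}.
Local Notation E := (R * 'rV[R]_d)%type.
Local Notation A := (option 'I_d).
Local Notation Z := (int * 'rV[int]_d)%type.

Definition average (w : R) (k : Z) (F : E -> R) : R :=
  w ^+ d.+1 * iterated_integral (fun c => (zcoord k c)%:~R / w)
     (fun c => ((zcoord k c)%:~R + 1) / w) (@all_axes d) F 0.

Variables (w : R) (k : Z).
Hypothesis w0 : 0 < w.

Let lo_lt_hi c : (zcoord k c)%:~R / w < ((zcoord k c)%:~R + 1) / w.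
Proof. by rewrite ltr_pM2r ?invr_gt0// ltrDl. Qed.

Let volume : \prod_(c <- @all_axes d)
  (((zcoord k c)%:~R + 1) / w - (zcoord k c)%:~R / w) = w ^- d.+1.
Proof.
rewrite big_all_axes (eq_bigr (fun=> w^-1)); last first.
  by move=> c _; rewrite -mulrBl addrC addKr mul1r.
by rewrite prodr_const card_option card_ord exprVn.
Qed.

Lemma average_linear : linear_on_continuous (average w k).
Proof.
split=> [F K Fc Kc|x F Fc]; rewrite /average.
  by rewrite iterated_integralD// mulrDr.
by rewrite iterated_integralZ// mulrCA.
Qed.

Lemma average_cst x : average w k (cst x) = x.
Proof.
by rewrite /average iterated_integral_cst// volume mulrCA mulfV ?mulr1// expf_neq0// gt_eqF.
Qed.

Lemma average_le (F : E -> R) (C : R) : continuous F ->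
  (forall ze, (forall c, (zcoord k c)%:~R / w <= coord ze c <= ((zcoord k c)%:~R + 1) / w) ->
     `|F ze| <= C) -> `|average w k F| <= C.
Proof.
move=> Fc FC; rewrite /average normrM ger0_norm ?exprn_ge0 ?(ltW w0)//.
rewrite -ler_pdivlMl ?exprn_gt0// mulrC -volume.
apply: iterated_integral_le => //.
by move=> c; rewrite mem_all_axes.
Qed.

End BoxAverage.

(** * The differentiated series and its limit *)

Section Operator.
Context {R : realType} {d n : nat}.
Local Notation E := (R * 'rV[R]_d)%type.
Local Notation A := (option 'I_d).
Local Notation Z := (int * 'rV[int]_d)%type.
Variable chi : A -> R -> R.
Hypothesis chiC : forall c, Cb n (chi c).
Hypothesis chiK : forall c, kernel_of_order n (chi c).
Hypothesis chiM : forall c l, (1 <= l <= n)%N ->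
  uniformly_convergent_moment n ((chi c)^`(l))%classic.
Variables (G : (A -> nat) -> E -> R) (M : R).
Hypothesis Gc : forall al, (mideg al <= n)%N -> continuous (G al).
Hypothesis Gd : forall al a z, (mideg al < n)%N ->
  is_derive z (axis a) (G al) (G (incr al a) z).
Hypothesis Gb : forall al z, mideg al = n -> `|G al z| <= M.
Hypothesis Gu : forall e : R, 0 < e -> exists2 dl : R, 0 < dl &
  forall al z z', mideg al = n -> (forall c, `|coord z c - coord z' c| <= dl) ->
    `|G al z - G al z'| <= e.
Local Notation moment := (tensor_moment (n := n) chi).
Implicit Types (w : R) (de be : A -> nat) (z : E) (k : Z).

Definition scaled w z : A -> R := fun c => w * coord z c.
Definition offset w z k : A -> R := fun c => `|scaled w z c - (zcoord k c)%:~R|.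

Definition local_taylor w be z k : R := taylor n G (average w k) (n - mideg be) be z.

(** A term of the operator after [de] derivatives have fallen on the kernel,
    each bringing out a factor [w], and [be] on the averaged Taylor polynomial,
    each lowering its order. *)
Definition series_term w de be z k : R :=
  w ^+ mideg de * (tensor_kernel chi de (scaled w z) k * local_taylor w be z k).

Definition series_sum w de be z : R := rsum (series_term w de be z).

(** Every point of the cell of [k] lies within [(1 + t) / w] of [z], where [t]
    is the largest offset. The cube of this size is kept in the hypothesis on
    the oscillation [om], while in the bound it is relaxed to the product over
    all coordinates, which matches the moments of the tensor kernel. *)
Lemma local_taylor_error w be z k om : 0 < w -> (mideg be <= n)%N -> 0 <= om ->
  (forall r al xi ze, (exists c, r = (1 + offset w z k c) / w) -> mideg al = n ->
     in_cube ze r xi -> `|G al xi - G al ze| <= om) ->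
  `|G be z - local_taylor w be z k| <=
    (d.+1%:R / w) ^+ (n - mideg be) * om * (\prod_c (1 + offset w z k c)) ^+ n.
Proof.
move=> w0 ben om0 hom.
have Ll := average_linear k w0.
set m := (n - mideg be)%N.
have bm : (mideg be + m)%N = n by rewrite /m subnKC.
have bm' : (mideg be + m <= n)%N by rewrite bm.
have [E1 cont] := taylorE Gc z Ll bm'.
pose dev ze := G be z - taylor n G (evaluation ze) m be z.
have devc : continuous dev by move=> ze; apply: cvgB; [exact: cvg_cst|exact: cont].
have -> : G be z - local_taylor w be z k = average w k dev.
  have [LD LZ] := Ll.
  have c2 : continuous (fun ze => -1 * taylor n G (evaluation ze) m be z).
    by move=> ze; apply: cvgM; [exact: cvg_cst|exact: cont].
  have -> : dev = (fun ze => cst (G be z) ze + -1 * taylor n G (evaluation ze) m be z).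
    by apply/funext => ze; rewrite /dev mulN1r.
  rewrite LD//; last by move=> x; exact: cvg_cst.
  by rewrite LZ// average_cst// mulN1r /local_taylor -/m E1.
have [c0 hc0] : exists c0, forall c, offset w z k c <= offset w z k c0.
  have [i _ hi] := @Order.TotalTheory.arg_maxP _ _ A None xpredT (offset w z k) isT.
  by exists i => c; exact: hi.
have off0 c : 0 <= offset w z k c by exact: normr_ge0.
pose r := (1 + offset w z k c0) / w.
have r0 : 0 <= r by rewrite divr_ge0 ?addr_ge0// ltW.
have le1 : 1 + offset w z k c0 <= \prod_c (1 + offset w z k c).
  rewrite (bigD1 c0)//= ler_peMr ?addr_ge0//.
  apply: (@le_trans _ _ (\prod_(c | c != c0) (1 : R))); first by rewrite big1.
  by apply: ler_prod => c _; rewrite ler01 lerDl off0.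
have T1 : 1 <= \prod_c (1 + offset w z k c).
  by apply: le_trans le1; rewrite lerDl.
apply: (@le_trans _ _ ((d.+1%:R * r) ^+ m * om)); last first.
  rewrite /r mulrCA mulrC [X in _ <= X]mulrAC mulrC ler_wpM2r// exprMn [leLHS]mulrC.
  rewrite ler_wpM2l ?exprn_ge0 ?divr_ge0 ?(ltW w0)//.
  apply: (@le_trans _ _ ((\prod_c (1 + offset w z k c)) ^+ m)).
    by apply: lerXn2r; rewrite ?nnegrE ?addr_ge0 ?(le_trans ler01 T1).
  by rewrite ler_weXn2l// leq_subr.
apply: average_le => // ze hze.
apply: (@taylor_remainder R d n G Gc Gd ze r om) => //.
  by move=> al xi aln xir; apply: (hom r) => //; exists c0.
move=> c; have /andP[z1 z2] := hze c.
rewrite /r ler_pdivlMr// -[X in _ * X](gtr0_norm w0) -normrM mulrBl.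
have {}z1 : (zcoord k c)%:~R <= coord ze c * w by rewrite -ler_pdivrMr.
have {}z2 : coord ze c * w <= (zcoord k c)%:~R + 1 by rewrite -ler_pdivlMr.
have := hc0 c; rewrite /offset /scaled; set y := `|w * coord z c0 - _|.
rewrite !ler_norml => /andP[y1 y2]; apply/andP; split; lra.
Qed.

Lemma top_bound_ge0 : 0 <= M.
Proof.
have h : mideg (fun c : A => if c is None then n else 0%N) = n.
  by rewrite midegE big1 ?addn0.
exact: le_trans (normr_ge0 _) (Gb 0 h).
Qed.

Lemma kernel_error w de be z k om : 0 < w -> (mideg be <= n)%N -> 0 <= om ->
  (forall r al xi ze, (exists c, r = (1 + offset w z k c) / w) -> mideg al = n ->
     in_cube ze r xi -> `|G al xi - G al ze| <= om) ->
  `|tensor_kernel chi de (scaled w z) k * (G be z - local_taylor w be z k)| <=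
    (d.+1%:R / w) ^+ (n - mideg be) * om * moment de (scaled w z) k.
Proof.
move=> w0 ben om0 hom; rewrite normrM tensor_moment_factor [leRHS]mulrA mulrC.
by rewrite ler_wpM2r//; exact: local_taylor_error.
Qed.

Let top_oscillation_le w z k r al xi ze :
  (exists c, r = (1 + offset w z k c) / w) -> mideg al = n ->
  in_cube ze r xi -> `|G al xi - G al ze| <= M + M.
Proof. by move=> _ aln _; rewrite (le_trans (ler_normB _ _))// lerD// Gb. Qed.

Lemma series_term_le w de be z k : 0 < w -> (mideg be <= n)%N ->
  `|series_term w de be z k| <=
    w ^+ mideg de * (`|G be z| + (d.+1%:R / w) ^+ (n - mideg be) * (M + M)) *
      moment de (scaled w z) k.
Proof.
move=> w0 ben; have M0 := top_bound_ge0.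
rewrite /series_term normrM ger0_norm ?exprn_ge0 ?(ltW w0)// -mulrA.
rewrite ler_wpM2l ?exprn_ge0 ?(ltW w0)//.
have -> : tensor_kernel chi de (scaled w z) k * local_taylor w be z k =
   tensor_kernel chi de (scaled w z) k * G be z -
   tensor_kernel chi de (scaled w z) k * (G be z - local_taylor w be z k) by ring.
rewrite (le_trans (ler_normB _ _))// mulrDl lerD//.
  by rewrite normrM mulrC ler_wpM2l//; exact: tensor_kernel_le.
by apply: kernel_error => //; [exact: addr_ge0|exact: top_oscillation_le].
Qed.

Lemma series_term_bounded w de be z : 0 < w -> (mideg de <= n)%N -> (mideg be <= n)%N ->
  exists B, sum_bounded (series_term w de be z) B.
Proof.
move=> w0 den ben; have [B hB] := tensor_moment_bounded chiC chiK chiM.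
pose C := w ^+ mideg de * (`|G be z| + (d.+1%:R / w) ^+ (n - mideg be) * (M + M)).
exists (`|C| * B); apply: sum_boundedW (sum_boundedZ C (hB de (scaled w z) den)) => k.
by rewrite [leRHS]ger0_norm; [exact: series_term_le|
  exact: le_trans (normr_ge0 _) (series_term_le _ _ _ w0 ben)].
Qed.

(** The error of the series against the limit splits into the nodes near
    [w z], where the modulus of continuity of the top derivatives is small,
    and the far nodes, whose weighted kernel mass is small. *)
Lemma series_sum_cvg de be : (mideg de + mideg be <= n)%N ->
  forall e : R, 0 < e -> exists2 W : R, 0 < W & forall w z, W <= w ->
    `|series_sum w de be z - (mideg de == 0%N)%:R * G be z| <= e.
Proof.
move=> dbn e e0.
have den : (mideg de <= n)%N by lia.
have ben : (mideg be <= n)%N by lia.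
have dem : (mideg de <= n - mideg be)%N by lia.
have M0 := top_bound_ge0.
have [B hB] := tensor_moment_bounded chiC chiK chiM.
have B0 : 0 <= B by exact: sum_bounded_ge0 (hB de (fun=> 0) den).
pose D : R := d.+1%:R ^+ n.
have D0 : 0 < D by rewrite exprn_gt0.
(* [e1] bounds the oscillation at the near nodes, [e2] the moment of the far
   nodes, and [D] the dimensional constant of the Taylor remainder. *)
pose e1 := e / 2 / (D * (B + 1)).
have e10 : 0 < e1 by rewrite !divr_gt0// mulr_gt0// ltr_wpDl.
pose e2 := e / 2 / (D * (M + M + 1)).
have e20 : 0 < e2 by rewrite !divr_gt0// mulr_gt0// ltr_wpDl// addr_ge0.
have [dl dl0 hdl] := Gu e10.
have [r hr] := tensor_moment_tail chiC chiK chiM e20.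
exists (Num.max 1 ((`|r| + 1) / dl)); first by rewrite lt_max ltr01.
move=> w z; rewrite ge_max => /andP[w1]; rewrite ler_pdivrMr// => wr.
have w0 : 0 < w by lra.
have [B1 hB1] := series_term_bounded z w0 den ben.
have kB : sum_bounded (tensor_kernel chi de (scaled w z)) B.
  exact: tensor_kernel_bounded (hB de (scaled w z) den).
pose main k := (w ^+ mideg de * G be z) * tensor_kernel chi de (scaled w z) k.
have mB := sum_boundedZ (w ^+ mideg de * G be z) kB.
have -> : (mideg de == 0%N)%:R * G be z = rsum main.
  rewrite (rsumZ _ kB) (rsum_tensor_kernel chiC chiK chiM _ den).
  by case: eqP => [->|_]; rewrite ?expr0 ?mulr1 ?mul1r// mul0r mulr0.
rewrite -(rsumB hB1 mB).
apply: rsum_le => s us.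
pose P c (i : int) := r <= `|scaled w z c - i%:~R|.
have bound k : `|series_term w de be z k - main k| <=
   D * e1 * moment de (scaled w z) k +
   D * (M + M) * (if [exists c, P c (zcoord k c)] then moment de (scaled w z) k else 0).
  have -> : series_term w de be z k - main k =
    - (w ^+ mideg de * (tensor_kernel chi de (scaled w z) k * (G be z - local_taylor w be z k))).
    by rewrite /series_term /main; ring.
  rewrite normrN normrM ger0_norm ?exprn_ge0 ?(ltW w0)//.
  have key om : 0 <= om ->
      (forall r al xi ze, (exists c, r = (1 + offset w z k c) / w) -> mideg al = n ->
         in_cube ze r xi -> `|G al xi - G al ze| <= om) ->
      w ^+ mideg de * `|tensor_kernel chi de (scaled w z) k * (G be z - local_taylor w be z k)|
      <= D * om * moment de (scaled w z) k.
    move=> om0 hom.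
    apply: (@le_trans _ _ (w ^+ mideg de * ((d.+1%:R / w) ^+ (n - mideg be) * om *
       moment de (scaled w z) k))).
      rewrite ler_wpM2l ?exprn_ge0 ?(ltW w0)//.
      exact: (kernel_error de w0 ben om0 hom).
    rewrite !mulrA ler_wpM2r ?tensor_moment_ge0// ler_wpM2r//.
    rewrite exprMn exprVn mulrCA -[leRHS]mulr1; apply: ler_pM.
    - exact: exprn_ge0.
    - by rewrite divr_ge0// exprn_ge0// ltW.
    - by rewrite ler_weXn2l ?leq_subr// ler1n.
    - by rewrite ler_pdivrMr ?exprn_gt0// mul1r ler_weXn2l.
  case: existsP => [_|far].
    apply: (@le_trans _ _ (D * (M + M) * moment de (scaled w z) k)).
      by apply: key; [exact: addr_ge0|exact: top_oscillation_le].
    by rewrite lerDr mulr_ge0 ?tensor_moment_ge0// mulr_ge0 ?ltW.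
  rewrite mulr0 addr0; apply: key; first exact: ltW.
  move=> _ al xi ze [c ->] aln cube; apply: hdl => // c'.
  apply: le_trans (cube c') _; rewrite ler_pdivrMr//.
  have : ~~ P c (zcoord k c) by apply/negP => Pc; apply: far; exists c.
  by rewrite /P -ltNge /offset; have := ler_norm r; lra.
apply: le_trans (ler_sum _ (fun k _ => bound k)) _.
rewrite big_split/= -!mulr_sumr -big_mkcond/=.
have S1 : \sum_(k <- s) moment de (scaled w z) k <= B.
  apply: le_trans (hB de (scaled w z) den s us).
  by apply: ler_sum => k _; exact: ler_norm.
have S2 : \sum_(k <- s | [exists c, P c (zcoord k c)]) moment de (scaled w z) k <= e2.
  exact: hr.
have F1 : D * e1 * B <= e / 2.
  have -> : e / 2 = D * e1 * (B + 1) by rewrite /e1; field; rewrite !gt_eqF//; lra.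
  by apply: ler_wpM2l; [rewrite mulr_ge0// ltW|rewrite lerDl].
have F2 : D * (M + M) * e2 <= e / 2.
  have -> : e / 2 = D * (M + M + 1) * e2 by rewrite /e2; field; rewrite !gt_eqF//; lra.
  by apply: ler_wpM2r; [exact: ltW|apply: ler_wpM2l; [exact: ltW|rewrite lerDl]].
rewrite [leRHS](splitr e) lerD//.
  by apply: le_trans F1; apply: ler_wpM2l => //; rewrite mulr_ge0// ltW.
by apply: le_trans F2; apply: ler_wpM2l => //; rewrite mulr_ge0 ?addr_ge0// ltW.
Qed.

Lemma is_derive_tensor_kernel w de a z k : (mideg de < n)%N ->
  is_derive z (axis a) (fun z => tensor_kernel chi de (scaled w z) k)
    (w * tensor_kernel chi (incr de a) (scaled w z) k).
Proof.
move=> den; have da : (de a < n)%N by apply: leq_ltn_trans den; exact: leq_mideg.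
have -> : z = (0 : R) *: axis a + z by rewrite scale0r add0r.
apply/is_derive_line.
pose C := \prod_(c | c != a) kernel_derive chi de c (scaled w z c - (zcoord k c)%:~R).
have -> : (fun h : R => tensor_kernel chi de (scaled w (h *: axis a + z)) k) =
    (fun h => C * kernel_derive chi de a (w * h + (w * coord z a - (zcoord k a)%:~R))).
  apply/funext => h; rewrite /tensor_kernel (bigD1 a)//= mulrC; congr (_ * _).
    by apply: eq_bigr => c ca; rewrite /scaled coord_line (negbTE ca) mulr0 add0r.
  by rewrite /scaled coord_line eqxx mulr1 mulrDr addrA.
rewrite scale0r add0r.
have -> : w * tensor_kernel chi (incr de a) (scaled w z) k =
    C * (w * ((chi a)^`((de a).+1))%classic (w * 0 + (w * coord z a - (zcoord k a)%:~R))).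
  rewrite mulrCA; congr (_ * _); rewrite /tensor_kernel (bigD1 a)//= mulrC; congr (_ * _).
    apply: eq_bigr => c ca.
    by rewrite /kernel_derive /incr (negbTE ca) addn0.
  by rewrite /kernel_derive /incr eqxx addn1 mulr0 add0r.
apply: is_derive_scale; apply: is_derive_affine.
rewrite derive1nS derive1E; apply: derivableP.
by have [+ _] := chiC a; apply.
Qed.

Lemma is_derive_series_term w de be a z k : 0 < w -> (mideg de + mideg be < n)%N ->
  is_derive z (axis a) (fun z => series_term w de be z k)
    (series_term w (incr de a) be z k + series_term w de (incr be a) z k).
Proof.
move=> w0 dbn.
have d1 : is_derive z (axis a) (fun z => tensor_kernel chi de (scaled w z) k)
    (w * tensor_kernel chi (incr de a) (scaled w z) k).
  by apply: is_derive_tensor_kernel; lia.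
have d2 : is_derive z (axis a) (fun z => local_taylor w be z k)
    (local_taylor w (incr be a) z k).
  rewrite /local_taylor mideg_incr.
  have -> : (n - mideg be)%N = (n - (mideg be).+1).+1 by lia.
  by apply: (is_derive_taylor Gc); [exact: average_linear|lia].
have -> : series_term w (incr de a) be z k + series_term w de (incr be a) z k =
  w ^+ mideg de * (tensor_kernel chi de (scaled w z) k * local_taylor w (incr be a) z k +
    local_taylor w be z k * (w * tensor_kernel chi (incr de a) (scaled w z) k)).
  by rewrite /series_term mideg_incr exprS; ring.
exact: is_derive_scale (is_derive_mul d1 d2).
Qed.

(** Near [z] the node [k] is far from [w z] as soon as one of its coordinates
    leaves a large interval, so the tails are locally uniformly small. *)
Lemma series_term_tail w de be a z : 0 < w -> (mideg de <= n)%N -> (mideg be <= n)%N ->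
  exists r B : R, [/\ 0 < r,
    forall h : R, `|h| < r -> sum_bounded (series_term w de be (h *: axis a + z)) B &
    forall e : R, 0 < e -> exists s0 : seq Z, forall h : R, `|h| < r ->
      forall s, uniq s -> (forall k, k \in s -> k \notin s0) ->
      \sum_(k <- s) `|series_term w de be (h *: axis a + z) k| <= e].
Proof.
move=> w0 den ben; have M0 := top_bound_ge0.
have [B hB] := tensor_moment_bounded chiC chiK chiM.
have B0 : 0 <= B by exact: sum_bounded_ge0 (hB de (fun=> 0) den).
pose C := w ^+ mideg de * (`|G be z| + 1 + (d.+1%:R / w) ^+ (n - mideg be) * (M + M)).
have C0 : 0 < C.
  rewrite mulr_gt0 ?exprn_gt0// ltr_wpDr// ?ltr_wpDl//.
  by rewrite mulr_ge0 ?addr_ge0// exprn_ge0// divr_ge0// ltW.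
have [r /andP[r0 r1] hr] : exists2 r : R, 0 < r <= 1 & forall h : R, `|h| < r ->
    `|G be (h *: axis a + z)| <= `|G be z| + 1.
  have cvg1 : (fun h : R => G be (h *: axis a + z)) @ (0 : R) --> G be z.
    have E1 : z = (0 : R) *: axis a + z by rewrite scale0r add0r.
    rewrite {2}E1.
    apply: (@continuous_comp R E R (fun h : R => h *: axis a + z) (G be)).
      by apply: cvgD; [apply: cvgZ (cvg_cst _); exact: cvg_id|exact: cvg_cst].
    exact: Gc.
  have /cvgrPdist_le/(_ _ ltr01)/nbhs_ballP[r /= r0 hr] := cvg1.
  exists (Num.min r 1); first by rewrite lt_min r0 ltr01 ge_min lexx orbT.
  move=> h; rewrite lt_min => /andP[hr' _].
  have /= := hr h; rewrite /ball/= sub0r normrN => /(_ hr').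
  have := ler_distD (G be z) (G be (h *: axis a + z)) 0.
  by rewrite !subr0 distrC; lra.
have bound (h : R) k : `|h| < r -> `|series_term w de be (h *: axis a + z) k| <=
    C * moment de (scaled w (h *: axis a + z)) k.
  move=> hh; apply: le_trans (series_term_le _ _ _ w0 ben) _.
  apply: ler_wpM2r; first exact: tensor_moment_ge0.
  by rewrite ler_wpM2l ?exprn_ge0 ?(ltW w0)// lerD2r hr.
exists r, (C * B); split => //.
  move=> h hh s us.
  apply: (@le_trans _ _ (\sum_(k <- s) C * moment de (scaled w (h *: axis a + z)) k)).
    by apply: ler_sum => k _; exact: bound.
  rewrite -mulr_sumr ler_wpM2l ?(ltW C0)//.
  apply: le_trans (hB de (scaled w (h *: axis a + z)) den s us).
  by apply: ler_sum => k _; exact: ler_norm.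
move=> e e0; have e'0 : 0 < e / C by rewrite divr_gt0.
have [t ht] := tensor_moment_tail chiC chiK chiM e'0.
have [N hN] : exists N, forall c (i : int), i \notin ints N -> t + w <= `|scaled w z c - i%:~R|.
  have /choice[N hN] : forall c, exists N, forall i, i \notin ints N ->
      t + w + 1 <= `|scaled w z c - i%:~R| by move=> c; exact: far_ints.
  exists (\max_c N c)%N => c i; rewrite mem_ints -ltnNge => iN.
  have /hN : i \notin ints (N c).
    rewrite mem_ints -ltnNge; apply: leq_ltn_trans iN; exact: leq_bigmax.
  lra.
exists (zbox N) => h hh s us sN.
apply: (@le_trans _ _ (\sum_(k <- s) C * moment de (scaled w (h *: axis a + z)) k)).
  by apply: ler_sum => k _; exact: bound.
rewrite -mulr_sumr mulrC -ler_pdivlMr//.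
apply: le_trans (ht de (scaled w (h *: axis a + z)) (fun _ i => i \notin ints N) s den _ us).
  rewrite [leRHS]big_mkcond !big_seq; apply: ler_sum => k /sN.
  by rewrite mem_zbox negb_forall => ->.
move=> c i /(hN c) hi; rewrite /scaled coord_line.
have : `|w * (h * (c == a)%:R)| <= w.
  rewrite normrM (gtr0_norm w0) ler_piMr ?(ltW w0)// normrM.
  have : `|h| <= 1 by lra.
  by case: eqP => _ h1; rewrite ?normr1 ?mulr1// normr0 mulr0.
move: hi; rewrite /scaled.
have := ler_distD (w * (h * (c == a)%:R + coord z c)) (w * coord z c) i%:~R.
rewrite mulrDr [`|w * coord z c - (_ + _)|]distrC addrK.
lra.
Qed.

Lemma is_derive_series_sum w de be a z : 0 < w -> (mideg de + mideg be < n)%N ->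
  is_derive z (axis a) (series_sum w de be)
    (series_sum w (incr de a) be z + series_sum w de (incr be a) z).
Proof.
move=> w0 dbn.
have [||r0 [B0 [r00 b0 _]]] := @series_term_tail w de be a z w0; [lia|lia|].
have [||r1 [B1 [r10 b1 t1]]] := @series_term_tail w (incr de a) be a z w0;
  [by rewrite mideg_incr; lia|lia|].
have [||r2 [B2 [r20 b2 t2]]] := @series_term_tail w de (incr be a) a z w0;
  [lia|by rewrite mideg_incr; lia|].
pose r := Num.min r0 (Num.min r1 r2).
have rpos : 0 < r by rewrite !lt_min r00 r10.
have lr (h : R) : `|h| < r -> [/\ `|h| < r0, `|h| < r1 & `|h| < r2].
  by rewrite !lt_min => /andP[-> /andP[-> ->]].
have [c0 c1 c2] : [/\ `|0 : R| < r0, `|0 : R| < r1 & `|0 : R| < r2] by rewrite normr0.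
have z0 : (0 : R) *: axis a + z = z by rewrite scale0r add0r.
have b1' := b1 0 c1; have b2' := b2 0 c2; rewrite z0 in b1' b2'.
have B1_0 := sum_bounded_ge0 b1'; have B2_0 := sum_bounded_ge0 b2'.
rewrite /series_sum -(rsumD b1' b2').
rewrite -{1 2 3}z0.
apply: ((@is_derive_line R E (fun y => rsum (series_term w de be y)) z (axis a) 0 _).1).
apply: (@is_derive_rsum R Z (fun k h => series_term w de be (h *: axis a + z) k)
  (fun k h => series_term w (incr de a) be (h *: axis a + z) k +
     series_term w de (incr be a) (h *: axis a + z) k) r (B0 + (B1 + B2))) => //.
- move=> k x _; apply: ((@is_derive_line R E (fun y => series_term w de be y k) z (axis a) x _).2).
  exact: (@is_derive_series_term w de be a (x *: axis a + z) k w0 dbn).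
- move=> x /lr[x0 _ _] s us; apply: le_trans (b0 x x0 s us) _.
  by rewrite lerDl addr_ge0.
- rewrite z0 => s us; apply: le_trans (sum_boundedD b1' b2' us) _.
  by rewrite lerDr; exact: sum_bounded_ge0 (b0 0 c0).
move=> e e0; have e20 : 0 < e / 2 by lra.
have [s1 hs1] := t1 _ e20; have [s2 hs2] := t2 _ e20.
exists (undup (s1 ++ s2)); first exact: undup_uniq.
move=> x /lr[_ x1 x2] t ut tn.
apply: (@le_trans _ _ (\sum_(k <- t) (`|series_term w (incr de a) be (x *: axis a + z) k| +
   `|series_term w de (incr be a) (x *: axis a + z) k|))).
  by apply: ler_sum => k _; exact: ler_normD.
rewrite big_split/= [leRHS](splitr e) lerD//.
  by apply: hs1 => // k /tn; rewrite mem_undup mem_cat negb_or => /andP[].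
by apply: hs2 => // k /tn; rewrite mem_undup mem_cat negb_or => /andP[].
Qed.

(** By the Leibniz rule every further derivative falls either on the kernel,
    and then the limit is [0], or on the Taylor factor, and then the limit is
    differentiated too. *)
Lemma pderivs_series_sum s de be : (mideg de + mideg be + size s <= n)%N ->
  (forall w, 0 < w -> pderivables s (series_sum w de be)) /\
  (forall e : R, 0 < e -> exists2 W : R, 0 < W & forall w z, W <= w ->
    `|pderivs s (series_sum w de be) z - (mideg de == 0%N)%:R * pderivs s (G be) z| <= e).
Proof.
elim/last_ind: s de be => [|s a IH] de be.
  by rewrite addn0 => dbn; split => // e e0; exact: series_sum_cvg.
rewrite size_rcons => dbn.
have [|p1 q1] := IH (incr de a) be; first by rewrite mideg_incr; lia.
have [|p2 q2] := IH de (incr be a); first by rewrite mideg_incr; lia.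
have dK w : 0 < w -> 'D_(axis a) (series_sum w de be) =
    (fun z => series_sum w (incr de a) be z + series_sum w de (incr be a) z).
  move=> w0; apply/funext => z.
  by have /@derive_val := @is_derive_series_sum w de be a z w0 ltac:(lia).
have dG : 'D_(axis a) (G be) = G (incr be a).
  apply/funext => z; by have /@derive_val := @Gd be a z ltac:(lia).
split=> [w w0|e e0].
  rewrite -cats1; apply/pderivables_cat; split.
    by split => // z; have [] := @is_derive_series_sum w de be a z w0 ltac:(lia).
  by rewrite /= dK//; have [] := pderivsD (p1 w w0) (p2 w w0).
have e20 : 0 < e / 2 by lra.
have [W1 W10 h1] := q1 _ e20; have [W2 W20 h2] := q2 _ e20.
exists (Num.max W1 W2); first by rewrite lt_max W10.
move=> w z; rewrite ge_max => /andP[w1 w2].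
have w0 : 0 < w by lra.
rewrite -cats1 !pderivs_cat /= dK// dG.
have [_ ->] := pderivsD (p1 w w0) (p2 w w0).
have := h1 w z w1; rewrite mideg_incr/= mul0r subr0 => A1.
have A2 := h2 w z w2.
rewrite -addrA (le_trans (ler_normD _ _))//; lra.
Qed.

End Operator.

(** * The Kantorovich operator *)

Section Kantorovich.
Context {R : realType} {d n : nat}.
Local Notation E := (R * 'rV[R]_d)%type.
Local Notation A := (option 'I_d).
Local Notation MI := {ffun A -> 'I_n.+1}.

Lemma mideg0 : mideg (fun _ : A => 0%N) = 0%N.
Proof. by rewrite /mideg big1. Qed.

Lemma mideg_mi (al : A -> nat) : mideg al = n -> exists g : MI, mi g = al.
Proof.
move=> aln; exists [ffun c => inord (al c)]; apply/funext => c.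
by rewrite /mi ffunE inordK// ltnS -aln leq_mideg.
Qed.

Lemma top_derivative_bound (f : E -> R) : Cn n f ->
  exists M, forall al z, mideg al = n -> `|pderivs (midirs al) f z| <= M.
Proof.
move=> [_ ft].
have [g r r' rr' h z gn|g|M hM] := @uniform_witness R MI
  (fun g M => forall z, mideg (mi g) = n -> `|pderivs (midirs (mi g)) f z| <= M).
- by apply: le_trans rr'; exact: h.
- have [gn|gn] := pselect (mideg (mi g) = n); last by exists 0.
  have [[M [_ hM]] _] : bounded_fun (pderivs (midirs (mi g)) f) /\
      unif_continuous (pderivs (midirs (mi g)) f) by apply: ft; rewrite -midegE.
  by exists (M + 1) => z _; apply: (hM (M + 1)); rewrite ?ltrDl.
- exists M => al z aln; have [g gal] := mideg_mi aln.
  by rewrite -gal; apply: hM; rewrite gal.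
Qed.

Lemma top_derivative_modulus (f : E -> R) : Cn n f -> forall e : R, 0 < e ->
  exists2 dl : R, 0 < dl & forall al z z', mideg al = n ->
    (forall c, `|coord z c - coord z' c| <= dl) ->
    `|pderivs (midirs al) f z - pderivs (midirs al) f z'| <= e.
Proof.
move=> [_ ft] e e0.
(* The modulus is encoded by its inverse, which may be enlarged. *)
have [g r r' rr' h t rt|g|r hr] := @uniform_witness R MI
  (fun g r => forall t, r <= t -> 0 < t -> forall z z', mideg (mi g) = n ->
     (forall c, `|coord z c - coord z' c| <= t^-1) ->
     `|pderivs (midirs (mi g)) f z - pderivs (midirs (mi g)) f z'| <= e).
- by apply: h; apply: le_trans rt.
- have [gn|gn] := pselect (mideg (mi g) = n); last by exists 0.
  have [_ /unif_continuousP/(_ e e0)[dl dl0 hdl]] :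
      bounded_fun (pderivs (midirs (mi g)) f) /\
      unif_continuous (pderivs (midirs (mi g)) f) by apply: ft; rewrite -midegE.
  exists (dl^-1 + 1) => t dlt t0 z z' _ zz'.
  have tdl : t^-1 < dl by rewrite invf_plt ?posrE//; lra.
  have /hdl : ball (z, z').1 dl (z, z').2.
    by apply: ball_coord => // c; apply: le_lt_trans tdl.
  exact: ltW.
exists (`|r| + 1)^-1; first by rewrite invr_gt0 ltr_wpDl.
move=> al z z' aln zz'; have [g gal] := mideg_mi aln; rewrite -gal.
apply: (hr g (`|r| + 1)); rewrite ?gal ?ltr_wpDl//.
by have := ler_norm r; lra.
Qed.

Definition kernel_family (phi : R -> R) (psi : 'I_d -> R -> R) (c : A) : R -> R :=
  if c is Some i then psi i else phi.

(** The order in the first variable and the multi-index in the others merge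
    into one multi-index, and the integrals over the cell into one iterated
    integral. *)
Lemma kantorovich_termE (w : R) phi psi (f : E -> R) (z : E) :
  kantorovich_term n w phi psi f z =
  series_term (n := n) (kernel_family phi psi) (fun al => pderivs (midirs al) f) w
    (fun=> 0%N) (fun=> 0%N) z.
Proof.
apply/funext => k; rewrite /kantorovich_term /series_term.
rewrite mideg0 expr0 mul1r; congr (_ * _).
  by rewrite /tensor_kernel big_option.
rewrite /local_taylor /taylor /hermite_mean.
rewrite mideg0 subn0 pair_big_dep /=.
pose h (x : 'I_n.+1 * {ffun 'I_d -> 'I_n.+1}) : MI :=
  [ffun c => if c is Some i then x.2 i else x.1].
pose h' (g : MI) : 'I_n.+1 * {ffun 'I_d -> 'I_n.+1} := (g None, [ffun i => g (Some i)]).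
have hK : cancel h h'.
  move=> [l j]; rewrite /h' /h ffunE; congr pair.
  by apply/ffunP => i; rewrite !ffunE.
have h'K : cancel h' h by move=> g; apply/ffunP => -[i|]; rewrite !ffunE.
rewrite [RHS](reindex h)/=; last by exists h' => x _; [exact: hK|exact: h'K].
have hE x c : mi (h x) c = if c is Some i then (x.2 i : nat) else (x.1 : nat).
  by rewrite /mi ffunE; case: c.
have hNone x : mi (h x) None = x.1 by rewrite hE.
have hSome x i : mi (h x) (Some i) = x.2 i by rewrite hE.
apply: eq_big => [[l j]|[l j] _] /=.
  by rewrite midegE hNone; under [in RHS]eq_bigr do rewrite hSome.
rewrite -mulrA; congr (_ * _).
  congr (_%:R^-1); rewrite /mi_fact big_option hNone /=.
  by congr (_ * _)%N; apply: eq_bigr => i _; rewrite hSome.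
rewrite /average -box_integralE; congr (_ * _).
apply: eq_Rintegral => u _; congr (box_integral _ _ _); apply/funext => v.
rewrite -mulrA; congr (_ * _).
  congr (pderivs (nseq _ None ++ flatten _) f (u, v)).
    by rewrite /mi_add hNone.
  by apply: eq_map => i; rewrite /mi_add hSome.
rewrite /monomial big_option hNone /=; congr (_ * _).
by apply: eq_bigr => i _; rewrite hSome.
Qed.

Lemma supnorm_cvg0 (F : R -> E -> R) :
  (forall e : R, 0 < e -> exists2 W : R, 0 < W & forall w z, W <= w -> `|F w z| <= e) ->
  supnorm (F w) @[w --> +oo%R] --> 0%E.
Proof.
move=> h.
have bound e : 0 < e -> \forall w \near +oo%R, (0 <= supnorm (F w) <= e%:E)%E.
  move=> /h[W _ hW]; exists W; split; first exact: num_real.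
  move=> w /ltW Ww; apply/andP; split.
    apply: (@le_trans _ _ (`|F w 0|)%:E); first by rewrite lee_fin.
    by apply: ereal_sup_ubound; exists 0.
  by apply: ge_ereal_sup => _ [z _ <-]; rewrite lee_fin hW.
apply/fine_cvgP; split.
  have := bound 1 ltr01; apply: filterS => w /andP[s0 s1].
  by rewrite ge0_fin_numE// (le_lt_trans s1)// ltry.
apply/cvgrPdist_le => e /bound; apply: filterS => w /andP[s0 s1].
rewrite sub0r normrN /= ger0_norm ?fine_ge0//.
by rewrite -lee_fin fineK// ge0_fin_numE// (le_lt_trans s1)// ltry.
Qed.

End Kantorovich.

Theorem theorem4 (R : realType) (d n : nat) (hd : (1 <= d)%N)
    (phi : R -> R) (psi : 'I_d -> R -> R)
    (phiC : Cb n phi) (psiC : forall i : 'I_d, Cb n (psi i))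
    (phiK : kernel_of_order n phi)
    (psiK : forall i : 'I_d, kernel_of_order n (psi i))
    (phiM : forall l : nat, (1 <= l <= n)%N ->
       uniformly_convergent_moment n (phi^`(l))%classic)
    (psiM : forall (i : 'I_d) (l : nat), (1 <= l <= n)%N ->
       uniformly_convergent_moment n ((psi i)^`(l))%classic)
    (f : R * 'rV[R]_d -> R) (fC : Cn n f)
    (p : nat) (q : 'I_d -> nat) (hpq : (p + \sum_i q i <= n)%N) :
  (* the operator and its derivative are well defined *)
  (forall w : R, 0 < w ->
     (forall z : R * 'rV[R]_d,
        summable [set: int * 'rV[int]_d]
          (EFin \o kantorovich_term n w phi psi f z)) /\
     has_pderiv p q (kantorovich n w phi psi f)) /\
  supnorm (fun z => pderiv p q (kantorovich n w phi psi f) z - pderiv p q f z)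
    @[w --> +oo%R] --> 0%E.
Proof.
pose chi := kernel_family phi psi.
have chiC c : Cb n (chi c) by case: c.
have chiK c : kernel_of_order n (chi c) by case: c.
have chiM c l : (1 <= l <= n)%N -> uniformly_convergent_moment n ((chi c)^`(l))%classic.
  by case: c => [i|]; [exact: psiM|exact: phiM].
pose G al := pderivs (@midirs d al) f.
have [fs _] := fC.
have Gc al : (mideg al <= n)%N -> continuous (G al).
  by rewrite -size_midirs => /fs[].
have Gd al a z : (mideg al < n)%N -> is_derive z (axis a) (G al) (G (incr al a) z).
  exact: (is_derive_midirs fs).
have [M Gb] := top_derivative_bound fC.
have Gu := top_derivative_modulus fC.
pose o : option 'I_d -> nat := fun=> 0%N.
have mo : mideg o = 0%N by exact: mideg0.
have KE w : kantorovich n w phi psi f = series_sum (n := n) chi G w o o.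
  by apply/funext => z; rewrite /kantorovich kantorovich_termE.
have Go : G o = f.
  by rewrite /G (_ : midirs o = [::])//; apply: size0nil; rewrite size_midirs.
have [|defined lim] := pderivs_series_sum chiC chiK chiM Gc Gd Gb Gu
  (s := directions p q) (de := o) (be := o).
  rewrite mo; have := size_midirs (fun c : option 'I_d => if c is Some i then q i else p).
  by rewrite midegE /midirs => ->.
split=> [w w0|].
  split=> [z|]; last by rewrite KE; exact: defined.
  rewrite kantorovich_termE.
  have [||B hB] := series_term_bounded chiC chiK chiM Gc Gd Gb z w0
    (de := o) (be := o); [by rewrite mo|by rewrite mo|].
  exact: sum_bounded_summable hB.
apply: supnorm_cvg0 => e /lim[W W0 hW]; exists W => // w z Ww.
by have := hW w z Ww; rewrite mo eqxx mul1r Go KE.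
Qed.
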